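(* Let $K$ be an algebraically closed field and let $A$ be a finite dimensional, non-semisimple, connected Nakayama algebra over $K$. Then $A$ is S-connected if and only if $A$ is quasi-hereditary.
   Context: Modules are finite dimensional right modules. A Nakayama algebra is a finite dimensional algebra such that every indecomposable module is uniserial (has a unique composition series). For a finite dimensional algebra $A$ put $\mathcal{O}_A=\{\operatorname{pdim} S \mid S \text{ a simple } A\text{-module}\}$, where $\operatorname{pdim}$ is projective dimension. $A$ is called S-connected if $A$ has finite global dimension and $\mathcal{O}_A$ is an interval in $\mathbb{N}_0$, i.e. for all simple $A$-modules $S_1,S_2$ and every natural number $k$ with $\operatorname{pdim} S_1\le k\le \operatorname{pdim} S_2$ there is a simple $A$-module $S_3$ with $\operatorname{pdim} S_3=k$. $A$ is called quasi-hereditary if there are a poset $X$ and a bijection $x\mapsto S_x$ from $X$ to the set of isomorphism classes of simple $A$-modules (let $P_x$ be the projective cover of $S_x$) such that for each $x\in X$ there exists a quotient module $\Delta(x)$ of $P_x$ with: (1) the kernel of the canonical epimorphism $\Delta(x)\to S_x$ is filtered by simple modules $S_y$ with $y<x$; (2) the kernel of the canonical epimorphism $P_x\to\Delta(x)$ is filtered by modules $\Delta(t)$ with $t>x$. *)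

(* Defs.v *)
From HB Require Import structures.
From mathcomp Require Import all_boot all_order all_algebra all_field.

Set Implicit Arguments.
Unset Strict Implicit.
Unset Printing Implicit Defensive.

Import GRing.Theory.
Local Open Scope ring_scope.

(* Finite dimensional right A-modules: [ract M a v] is the product v . a, so   *)
(* that v . (a * b) = (v . a) . b.                                             *)
Record rmod (K : fieldType) (A : falgType K) := RMod {
  rmod_vect :> vectType K;
  ract : A -> 'End(rmod_vect);
  ract_linear : linear ract;
  ract1 : ract 1 = \1%VF;
  ractM : forall a b : A, ract (a * b) = (ract b \o ract a)%VF
}.

Section Modules.
Variables (K : fieldType) (A : falgType K).
Implicit Types M N P S : rmod A.

Definition is_submod M (U : {vspace M}) : Prop :=
  forall a : A, (ract M a @: U <= U)%VS.

Definition is_rhom M N (f : 'Hom(M, N)) : Prop :=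
  forall (a : A) (v : M), f (ract M a v) = ract N a (f v).

Definition is_repi M N (f : 'Hom(M, N)) : Prop :=
  is_rhom f /\ limg f = fullv.

Definition rmod_iso M N : Prop :=
  exists2 f : 'Hom(M, N), is_rhom f & lker f = 0%VS /\ limg f = fullv.

Definition rmod_nonzero M : Prop := (fullv : {vspace M}) <> 0%VS.

Definition simple_rmod M : Prop :=
  rmod_nonzero M /\
  forall U : {vspace M}, is_submod U -> U = 0%VS \/ U = fullv.

Definition indecomposable_rmod M : Prop :=
  rmod_nonzero M /\
  forall U V : {vspace M}, is_submod U -> is_submod V ->
    (U + V)%VS = fullv -> (U :&: V)%VS = 0%VS -> U = 0%VS \/ V = 0%VS.

(* The subquotient V / U of M is isomorphic to N. A linear map on V extends to *)
(* M, hence the epimorphism V -> N with kernel U is represented by a linear    *)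
(* map on M that is only required to commute with the action on V.             *)
Definition factor_iso M (U V : {vspace M}) N : Prop :=
  exists f : 'Hom(M, N),
    [/\ forall (a : A) (v : M), v \in V -> f (ract M a v) = ract N a (f v),
        (f @: V)%VS = fullv,
        (U <= V)%VS
      & (V :&: lker f)%VS = U].

(* s = [:: U_1; ...; U_r] is a chain of submodules of M with U_r = W whose     *)
(* factors U_1 / 0, U_2 / U_1, ..., U_r / U_(r-1) belong to F. The term 0 is   *)
(* left implicit, and r = 0 is allowed (then W = 0).                           *)
Definition filtration (F : rmod A -> Prop) M (W : {vspace M})
    (s : seq {vspace M}) : Prop :=
  [/\ last 0%VS s = W,
      forall U, U \in s -> is_submod U
    & forall i, (i < size s)%N ->
        exists2 N, F N & factor_iso (nth 0%VS (0%VS :: s) i) (nth 0%VS s i) N].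

Definition filtered_by (F : rmod A -> Prop) M (W : {vspace M}) : Prop :=
  exists s, filtration F W s.

Definition composition_series M (s : seq {vspace M}) : Prop :=
  filtration simple_rmod fullv s.

Definition uniserial M : Prop :=
  exists! s : seq {vspace M}, composition_series s.

Definition projective_rmod P : Prop :=
  forall (M N : rmod A) (g : 'Hom(M, N)) (f : 'Hom(P, N)),
    is_repi g -> is_rhom f ->
    exists2 h : 'Hom(P, M), is_rhom h & (g \o h)%VF = f.

Definition projective_cover P M (p : 'Hom(P, M)) : Prop :=
  [/\ projective_rmod P, is_repi p
    & forall U : {vspace P}, is_submod U -> (U + lker p)%VS = fullv ->
        U = fullv].

Definition projective_resolution M (P : nat -> rmod A)
    (d : forall i, 'Hom(P i.+1, P i)) (e : 'Hom(P 0%N, M)) : Prop :=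
  [/\ forall i, projective_rmod (P i),
      forall i, is_rhom (d i),
      is_repi e,
      limg (d 0%N) = lker e
    & forall i, limg (d i.+1) = lker (d i)].

Definition pdim_le M (n : nat) : Prop :=
  exists (P : nat -> rmod A) (d : forall i, 'Hom(P i.+1, P i))
         (e : 'Hom(P 0%N, M)),
    projective_resolution d e /\ forall i, (n < i)%N -> ~ rmod_nonzero (P i).

(* pdim M = n; an infinite projective dimension is the absence of such an n.   *)
Definition pdim_eq M (n : nat) : Prop :=
  pdim_le M n /\ forall m, pdim_le M m -> (n <= m)%N.

End Modules.

Section Algebras.
Variables (K : fieldType) (A : falgType K).

Definition nakayama : Prop :=
  forall M : rmod A, indecomposable_rmod M -> uniserial M.

(* falgType excludes the zero algebra, so both factors are nonzero.            *)
Definition connected_alg : Prop :=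
  forall (B C : falgType K) (f : {lrmorphism A -> (B * C)%type}),
    ~ bijective f.

Definition semisimple_rmod (M : rmod A) : Prop :=
  exists (n : nat) (U : 'I_n -> {vspace M}),
    [/\ forall i, is_submod (U i),
        forall i, exists2 S : rmod A, simple_rmod S & factor_iso 0%VS (U i) S,
        (\sum_i U i)%VS = fullv
      & directv (\sum_i U i)%VS].

Definition semisimple_alg : Prop := forall M : rmod A, semisimple_rmod M.

Definition finite_gldim : Prop :=
  exists n : nat, forall M : rmod A, pdim_le M n.

Definition simple_pdims (k : nat) : Prop :=
  exists2 S : rmod A, simple_rmod S & pdim_eq S k.

Definition S_connected : Prop :=
  finite_gldim /\
  forall i j k : nat, simple_pdims i -> simple_pdims j ->
    (i <= k <= j)%N -> simple_pdims k.

(* p x : P x -> S x is the projective cover, q x : P x -> Delta x presents     *)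
(* Delta x as a quotient of P x, and r x is the canonical epimorphism, i.e.    *)
(* the factorization of p x through q x.                                       *)
Definition quasi_hereditary : Prop :=
  exists (disp : Order.disp_t) (X : porderType disp) (S P Delta : X -> rmod A)
         (p : forall x, 'Hom(P x, S x)) (q : forall x, 'Hom(P x, Delta x))
         (r : forall x, 'Hom(Delta x, S x)),
    [/\ forall x, simple_rmod (S x),
        forall x y, rmod_iso (S x) (S y) -> x = y,
        forall M : rmod A, simple_rmod M -> exists x, rmod_iso M (S x),
        forall x, projective_cover (p x)
      & forall x,
          [/\ is_repi (q x),
              is_repi (r x),
              (r x \o q x)%VF = p x,
              filtered_by
                (fun N => exists2 y, (y < x)%O & rmod_iso N (S y)) (lker (r x))
            & filtered_by
                (fun N => exists2 t, (x < t)%O & rmod_iso N (Delta t))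
                (lker (q x))]].

End Algebras.

(* Main.v *)
(* Number the simple modules by their position on the quiver, so that the      *)
(* radical layers of P_a have tops S_a, S_(a+1), ..., S_(f a - 1); extended    *)
(* periodically to the natural numbers with period n, f is nondecreasing and   *)
(* f (a + n) = f a + n. The uniserial module [a, b) has syzygy [b, f a), hence *)
(* pdim S_a is read off the first two equal consecutive terms of the sequence  *)
(* a+1, f a, f (a+1), f (f a), ...                                             *)
(* Both properties amount to the existence of a vertex x with f x <= x + n     *)
(* such that f y <= x + n or f y = f x + n whenever x < y < x + n: then P_x is *)
(* a heredity projective, and deleting x leaves a linear quiver.               *)
(* - If A is S-connected, then either f a = a + 1 for some a, and x = a + 1    *)
(*   works, or the projective dimensions of the simples are at least 1 and     *)
(*   take the value 1 and a value >= 2, hence the value 2; pdim S_a = 2 means  *)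
(*   f (a + 1) = f (f a), and x = f a works.                                   *)
(* - From such an x, the order x > x+1 > ... > x+n-1 with Delta_y = [y, min    *)
(*   (f y, x + n)) is quasi-hereditary. Moreover pdim S_y is at most one more  *)
(*   than the largest pdim S_z with y < z < x + n, so every value k >= 1 below *)
(*   pdim S_y is attained at the last z with pdim S_z >= k.                    *)
(* - If A is quasi-hereditary, a maximal element of the poset is such an x.    *)
Require Import Defs.
From HB Require Import structures.
From mathcomp Require Import all_boot all_order all_algebra all_field.
From mathcomp Require Import boolp zify.

Set Implicit Arguments.
Unset Strict Implicit.
Unset Printing Implicit Defensive.

Import GRing.Theory.
Local Open Scope ring_scope.

(** * Homomorphisms, submodules and quotients *)

(** Everything is reduced to one function on the integers. The Nakayama condition makes each
    indecomposable projective uniserial. Two projectives whose nonzero radicals have the same top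
    could be glued along it into an indecomposable module with two tops, so the top of the radical
    determines the projective; connectedness then puts all simples on one cycle ([kupisch]).
    Unrolling the cycle, P_a becomes an interval [a, f a) with f = [kup] nondecreasing and periodic
    up to a shift by n.

    On the homological side, [a, b) with a < b is projective exactly when b = f a, and otherwise has
    syzygy [b, f a) ([pd_interval]), so the projective dimensions of the simples are read off f. On
    the order side, a standard module at a maximal vertex x is P_x itself; being projective, it
    splits off any step of a filtration that maps onto it, and inside a uniserial P_y this forces
    the tail of P_y from x + n on to be zero or a copy of P_x. That is [heredity].

    The two sides meet in this condition. A finite global dimension whose values have no gap
    provides a simple of dimension 0, or one of dimension 2, and either produces a heredity vertex
    ([S_connected_heredity]). Conversely, cutting the cycle at such a vertex gives a linear order
    along which projective dimensions grow by at most one ([heredity_pd_step]), hence without gaps,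
    and along which truncated projectives are standard modules ([heredity_quasi_hereditary]). The
    remaining implication is [quasi_hereditary_heredity]. *)

Record rhom (K : fieldType) (A : falgType K) (M N : rmod A) :=
  Rhom { rlf :> 'Hom(M, N); rhomP : is_rhom rlf }.

Section Homs.
Variables (K : fieldType) (A : falgType K).
Implicit Types M N P : rmod A.

Lemma rhom_act M N (f : rhom M N) a v : f (ract M a v) = ract N a (f v).
Proof. exact: rhomP. Qed.

Lemma ractE M (a b : A) v : ract M (a * b) v = ract M b (ract M a v).
Proof. by rewrite ractM comp_lfunE. Qed.

Lemma rid_subproof M : is_rhom (\1%VF : 'Hom(M, M)).
Proof. by move=> a v; rewrite !id_lfunE. Qed.
Definition rid M := Rhom (@rid_subproof M).
Lemma ridE M v : rid M v = v. Proof. exact: id_lfunE. Qed.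

Lemma rcomp_subproof M N P (f : rhom N P) (g : rhom M N) :
  is_rhom (f \o g)%VF.
Proof. by move=> a v; rewrite !comp_lfunE !rhom_act. Qed.
Definition rcomp M N P (f : rhom N P) (g : rhom M N) := Rhom (rcomp_subproof f g).
Lemma rcompE M N P (f : rhom N P) (g : rhom M N) v : rcomp f g v = f (g v).
Proof. exact: comp_lfunE. Qed.

Lemma radd_subproof M N (f g : rhom M N) : is_rhom (rlf f + rlf g).
Proof. by move=> a v; rewrite !add_lfunE !rhom_act linearD. Qed.
Definition radd M N (f g : rhom M N) := Rhom (radd_subproof f g).
Lemma raddE M N (f g : rhom M N) v : radd f g v = f v + g v.
Proof. exact: add_lfunE. Qed.

Lemma ropp_subproof M N (f : rhom M N) : is_rhom (- rlf f).
Proof. by move=> a v; rewrite !opp_lfunE !rhom_act linearN. Qed.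
Definition ropp M N (f : rhom M N) := Rhom (ropp_subproof f).
Lemma roppE M N (f : rhom M N) v : ropp f v = - f v.
Proof. exact: opp_lfunE. Qed.

Lemma rzero_subproof M N : is_rhom (0 : 'Hom(M, N)).
Proof. by move=> a v; rewrite !zero_lfunE linear0. Qed.
Definition rzero M N := Rhom (@rzero_subproof M N).
Lemma rzeroE M N v : rzero M N v = 0. Proof. exact: zero_lfunE. Qed.

Definition rE := (ridE, rcompE, raddE, roppE, rzeroE).

Lemma submodP M (U : {vspace M}) :
  is_submod U <-> forall a v, v \in U -> ract M a v \in U.
Proof.
split=> [sU a v vU | sU a]; first by apply: (subvP (sU a)); apply: memv_img.
by apply/subvP => _ /memv_imgP[v vU ->]; apply: sU.
Qed.

Lemma submod0 M : is_submod (0%VS : {vspace M}).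
Proof. by move=> a; rewrite limg0. Qed.

Lemma submodf M : is_submod (fullv : {vspace M}).
Proof. by move=> a; apply: subvf. Qed.

Lemma submodD M (U V : {vspace M}) :
  is_submod U -> is_submod V -> is_submod (U + V)%VS.
Proof. by move=> sU sV a; rewrite limgD; apply: addvS. Qed.

Lemma submodI M (U V : {vspace M}) :
  is_submod U -> is_submod V -> is_submod (U :&: V)%VS.
Proof.
move=> /submodP sU /submodP sV; apply/submodP => a v.
by rewrite !memv_cap => /andP[/sU-> /sV->].
Qed.

Lemma submod_img M N (f : rhom M N) U : is_submod U -> is_submod (f @: U)%VS.
Proof.
move=> /submodP sU; apply/submodP => a _ /memv_imgP[v vU ->].
by rewrite -rhom_act memv_img // sU.
Qed.

Lemma preimE M N (f : 'Hom(M, N)) W v : (v \in (f @^-1: W)%VS) = (f v \in W).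
Proof. by rewrite -memv_preim. Qed.

Lemma submod_preim M N (f : rhom M N) W :
  is_submod W -> is_submod (f @^-1: W)%VS.
Proof.
move=> /submodP sW; apply/submodP => a v.
by rewrite !preimE rhom_act; apply: sW.
Qed.

Lemma submod_ker M N (f : rhom M N) : is_submod (lker f).
Proof. by apply/submodP => a v; rewrite !memv_ker rhom_act => /eqP->; rewrite linear0. Qed.

Lemma submod_limg M N (f : rhom M N) : is_submod (limg f).
Proof. exact/submod_img/submodf. Qed.

Lemma subfvP (V : vectType K) (U : {vspace V}) : reflect (U = fullv) (fullv <= U)%VS.
Proof. by apply: (iffP idP) => [fU|->//]; apply/eqP; rewrite eqEsubv subvf. Qed.

Lemma limgP M N (f : 'Hom(M, N)) w : reflect (exists v, w = f v) (w \in limg f).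
Proof.
apply: (iffP memv_imgP) => [[v _ ->]|[v ->]]; first by exists v.
by exists v; rewrite ?memvf.
Qed.

Lemma limg_fullP M N (f : 'Hom(M, N)) :
  limg f = fullv <-> forall w, exists v, w = f v.
Proof.
split=> [fE w|fE]; first by apply/limgP; rewrite fE memvf.
by apply/subfvP/subvP => w _; apply/limgP.
Qed.

Lemma lker0_inj M N (f : 'Hom(M, N)) : lker f = 0%VS <-> injective f.
Proof. by split=> [/eqP/lker0P|/lker0P/eqP]. Qed.

Lemma limg0P M N (f : 'Hom(M, N)) : limg f = 0%VS <-> forall v, f v = 0.
Proof.
split=> [f0 v | f0]; first by apply/eqP; rewrite -memv0 -f0 memv_img ?memvf.
by apply/eqP; rewrite -subv0; apply/subvP => _ /limgP[v ->]; rewrite f0 mem0v.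
Qed.

Lemma lkerfP M N (f : 'Hom(M, N)) : lker f = fullv <-> forall v, f v = 0.
Proof.
split=> [f0 v | f0]; first by apply/eqP; rewrite -memv_ker f0 memvf.
by apply/subfvP/subvP => v _; rewrite memv_ker f0.
Qed.

Lemma limg_subP M N (f : 'Hom(M, N)) (U : {vspace N}) :
  (forall v, f v \in U) -> (limg f <= U)%VS.
Proof. by move=> fU; apply/subvP => _ /limgP[v ->]. Qed.

Lemma limg_rcomp M N P (f : rhom N P) (g : rhom M N) :
  limg (rcomp f g) = (f @: limg g)%VS.
Proof. by rewrite -limg_comp. Qed.

(** The map [g^-1] is only a linear section of [g]; its failure to respect the action takes values
    in [lker g], which [f] kills. *)
Lemma factor_epi M N L (g : rhom M N) (f : rhom M L) :
  limg g = fullv -> (lker g <= lker f)%VS ->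
  exists h : rhom N L, forall v, h (g v) = f v.
Proof.
move=> g_epi /subvP kgf.
have hE v : (rlf f \o g^-1)%VF (g v) = f v.
  rewrite comp_lfunE; apply/eqP; rewrite -subr_eq0 -linearB -memv_ker kgf //.
  by rewrite memv_ker linearB /= limg_lfunVK ?subrr ?memv_img ?memvf.
have rh : is_rhom (rlf f \o g^-1)%VF.
  move=> a w; have /limg_fullP/(_ w)[v ->] := g_epi.
  by rewrite -rhom_act !hE rhom_act.
by exists (Rhom rh).
Qed.

Lemma factor_mono M N L (i : rhom N M) (f : rhom L M) :
  lker i = 0%VS -> (limg f <= limg i)%VS ->
  exists h : rhom L N, forall v, i (h v) = f v.
Proof.
move=> i_mono /subvP fi.
have hE v : i ((i^-1 \o f)%VF v) = f v.
  by rewrite comp_lfunE limg_lfunVK // fi // memv_img ?memvf.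
have rh : is_rhom (i^-1 \o f)%VF.
  move=> a v; apply: ((lker0_inj i).1 i_mono).
  by rewrite rhom_act !hE rhom_act.
by exists (Rhom rh).
Qed.

Lemma sub_exists M (U : {vspace M}) : is_submod U ->
  exists N (i : rhom N M), lker i = 0%VS /\ limg i = U.
Proof.
move=> /submodP sU.
pose i : 'Hom(subvs_of U, M) := linfun vsval.
have iE u : i u = vsval u by rewrite lfunE.
pose j : 'Hom(M, subvs_of U) := linfun (vsproj U).
have ij v : v \in U -> i (j v) = v by move=> vU; rewrite iE lfunE /= vsprojK.
have i_inj : injective i by move=> u v; rewrite !iE => /subvs_inj.
have iU u : i u \in U by rewrite iE subvsP.
pose act a : 'End(subvs_of U) := (j \o (ract M a \o i))%VF.
have actE a u : i (act a u) = ract M a (i u).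
  by rewrite !comp_lfunE ij // sU.
have act_lin : linear act.
  move=> k a b; apply/lfunP => u; apply: i_inj.
  rewrite actE ract_linear !add_lfunE !scale_lfunE linearD linearZ /=.
  by rewrite !actE.
have act1 : act 1 = \1%VF.
  by apply/lfunP => u; apply: i_inj; rewrite actE ract1 !id_lfunE.
have actM a b : act (a * b) = (act b \o act a)%VF.
  by apply/lfunP => u; apply: i_inj; rewrite actE comp_lfunE !actE ractE.
have ri : @is_rhom _ _ (RMod act_lin act1 actM) M i by move=> a u; exact: actE.
exists (RMod act_lin act1 actM), (Rhom ri); split; first exact/lker0_inj.
apply/vspaceP => v; apply/limgP/idP => [[u ->]|vU]; first exact: iU.
by exists (j v); rewrite ij.
Qed.

(** The quotient is carried by a linear complement of [U]: include it into [M] by [j], act there,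
    and project back along [U] by [q]. *)
Lemma quo_exists M (U : {vspace M}) : is_submod U ->
  exists N (q : rhom M N), limg q = fullv /\ lker q = U.
Proof.
move=> /submodP sU.
pose j : 'Hom(subvs_of (U^C)%VS, M) := linfun vsval.
have jE u : j u = vsval u by rewrite lfunE.
have dUC : (U^C :&: U)%VS = 0%VS by rewrite capvC capv_compl.
have [q jqE] : exists q : 'Hom(M, subvs_of (U^C)%VS), forall v, j (q v) = daddv_pi U^C U v.
  exists (linfun (vsproj U^C) \o (daddv_pi U^C U))%VF => v.
  by rewrite jE comp_lfunE lfunE /= vsprojK // memv_pi.
have qj u : q (j u) = u.
  apply: subvs_inj; rewrite -!jE jqE daddv_pi_id // jE subvsP //.
have decomp v : daddv_pi U^C U v + daddv_pi U U^C v = v.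
  by apply: daddv_pi_add => //; rewrite addvC addv_complf memvf.
have kerq v : (q v == 0) = (v \in U).
  rewrite -(inj_eq (@subvs_inj _ _ _)) -jE jqE linear0.
  apply/eqP/idP => [v0|vU].
    by rewrite -(decomp v) v0 add0r memv_pi.
  have := decomp v; rewrite (daddv_pi_id _ vU) 1?capvC //.
  by move/(canRL (addrK _)); rewrite subrr.
have qE v w : (v - w \in U) -> q v = q w.
  by rewrite -kerq linearB subr_eq0 => /eqP.
pose act a : 'End(subvs_of (U^C)%VS) := (q \o (ract M a \o j))%VF.
have actE a v : act a (q v) = q (ract M a v).
  rewrite !comp_lfunE; apply: qE; rewrite -linearB sU //.
  by rewrite -kerq linearB /= qj subrr.
have q_epi w : exists v, w = q v by exists (j w); rewrite qj.
have act_lin : linear act.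
  move=> k a b; apply/lfunP => w; have [v ->] := q_epi w.
  rewrite actE ract_linear !add_lfunE !scale_lfunE linearD linearZ /=.
  by rewrite !actE.
have act1 : act 1 = \1%VF.
  by apply/lfunP => w; have [v ->] := q_epi w; rewrite actE ract1 !id_lfunE.
have actM a b : act (a * b) = (act b \o act a)%VF.
  by apply/lfunP => w; have [v ->] := q_epi w; rewrite comp_lfunE !actE ractE.
have rq : @is_rhom _ _ M (RMod act_lin act1 actM) q by move=> a u; rewrite -actE.
exists (RMod act_lin act1 actM), (Rhom rq); split.
  exact/(@limg_fullP M (RMod act_lin act1 actM)).
by apply/vspaceP => v; rewrite memv_ker kerq.
Qed.

Lemma dsum_exists M N :
  exists D (i : rhom M D) (j : rhom N D) (p : rhom D M) (q : rhom D N),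
    [/\ forall x, p (i x) = x, forall y, q (j y) = y, forall x, q (i x) = 0,
        forall y, p (j y) = 0 & forall z, z = i (p z) + j (q z)].
Proof.
pose D : vectType K := (M * N)%type.
have il : linear (fun x : M => (x, 0) : D).
  by move=> k x y; congr pair; rewrite /= scaler0 addr0.
have jl : linear (fun y : N => (0, y) : D).
  by move=> k x y; congr pair; rewrite /= scaler0 addr0.
have pl : linear (fun z : D => z.1) by [].
have ql : linear (fun z : D => z.2) by [].
have lin2 (U V : vectType K) (f : U -> V) : linear f ->
    exists g : 'Hom(U, V), forall x, g x = f x.
  move=> lf; pose fl := GRing.isLinear.Build K U V *:%R f lf.
  pose ff : {linear U -> V} := HB.pack f fl.
  by exists (linfun ff) => x; rewrite lfunE.
have [i iE] := lin2 _ _ _ il; have [j jE] := lin2 _ _ _ jl.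
have [p pE] := lin2 _ _ _ pl; have [q qE] := lin2 _ _ _ ql.
have pi x : p (i x) = x by rewrite pE iE.
have qj x : q (j x) = x by rewrite qE jE.
have qi x : q (i x) = 0 by rewrite qE iE.
have pj x : p (j x) = 0 by rewrite pE jE.
have dec z : z = i (p z) + j (q z).
  by rewrite iE jE pE qE; case: z => x y; congr pair; rewrite /= ?addr0 ?add0r.
have inj z z' : p z = p z' -> q z = q z' -> z = z'.
  by move=> ep eq; rewrite (dec z) (dec z') ep eq.
pose act a : 'End(D) := ((i \o (ract M a \o p)) + (j \o (ract N a \o q)))%VF.
have pact a z : p (act a z) = ract M a (p z).
  by rewrite add_lfunE !comp_lfunE linearD /= pi pj addr0.
have qact a z : q (act a z) = ract N a (q z).
  by rewrite add_lfunE !comp_lfunE linearD /= qj qi add0r.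
move: act pact qact => act pact qact.
have act_lin : linear act.
  move=> k a b; apply/lfunP => z; rewrite add_lfunE scale_lfunE; apply: inj.
    by rewrite pact ract_linear add_lfunE scale_lfunE linearD linearZ /= !pact.
  by rewrite qact ract_linear add_lfunE scale_lfunE linearD linearZ /= !qact.
have act1 : act 1 = \1%VF.
  by apply/lfunP => z; apply: inj; rewrite ?pact ?qact ract1 !id_lfunE.
have actM a b : act (a * b) = (act b \o act a)%VF.
  by apply/lfunP => z; apply: inj; rewrite comp_lfunE ?pact ?qact ractE.
pose DD := RMod act_lin act1 actM.
have ri : @is_rhom _ _ M DD i.
  by move=> a x; apply: inj; rewrite ?pact ?qact ?pi ?qi ?linear0.
have rj : @is_rhom _ _ N DD j.
  by move=> a x; apply: inj; rewrite ?pact ?qact ?pj ?qj ?linear0.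
have rp : @is_rhom _ _ DD M p by move=> a z; exact: pact.
have rq : @is_rhom _ _ DD N q by move=> a z; exact: qact.
by exists DD, (Rhom ri), (Rhom rj), (Rhom rp), (Rhom rq).
Qed.

Lemma min_vspace (V : vectType K) (Q : {vspace V} -> Prop) U : Q U ->
  exists U0, [/\ Q U0, (U0 <= U)%VS & forall W, Q W -> (W <= U0)%VS -> W = U0].
Proof.
have [n] := ubnP (\dim U); elim: n U => // n IH U ltUn QU.
have [min|/existsNP[W /not_implyP[QW /not_implyP[WU neWU]]]] :=
  pselect (forall W, Q W -> (W <= U)%VS -> W = U); first by exists U; split.
have [|U0 [QU0 U0W min]] := IH W _ QW.
  rewrite ltnS in ltUn; apply: leq_trans ltUn.
  by rewrite ltnNge; apply/negP => le; apply/neWU/eqP; rewrite eqEdim WU.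
by exists U0; split=> //; apply: subv_trans WU.
Qed.

Lemma max_vspace (V : vectType K) (Q : {vspace V} -> Prop) U : Q U ->
  exists U0, [/\ Q U0, (U <= U0)%VS & forall W, Q W -> (U0 <= W)%VS -> W = U0].
Proof.
have [n] := ubnP (dim V - \dim U); elim: n U => // n IH U ltUn QU.
have [max|/existsNP[W /not_implyP[QW /not_implyP[UW neWU]]]] :=
  pselect (forall W, Q W -> (U <= W)%VS -> W = U); first by exists U; split.
have [|U0 [QU0 WU0 max]] := IH W _ QW.
  rewrite ltnS in ltUn; apply: leq_trans ltUn.
  have ltUW : (\dim U < \dim W)%N.
    by rewrite ltnNge; apply/negP => le; apply/neWU/esym/eqP; rewrite eqEdim UW.
  by rewrite ltn_sub2l // (leq_trans ltUW) // -dimvf dimvS ?subvf.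
by exists U0; split=> //; apply: subv_trans WU0.
Qed.

End Homs.

(** * Projective and simple modules *)

Section ProjectiveSimple.
Variables (K : fieldType) (A : falgType K).
Implicit Types M N P S T : rmod A.

Lemma proj_lift P M N (g : rhom M N) (f : rhom P N) :
  projective_rmod P -> (limg f <= limg g)%VS ->
  exists h : rhom P M, forall v, g (h v) = f v.
Proof.
move=> projP fg; have [I [i [i0 iE]]] := sub_exists (submod_limg g).
have [|f' f'E] := factor_mono i0 (f := f); first by rewrite iE.
have [|g' g'E] := factor_mono i0 (f := g); first by rewrite iE.
have g'_epi : limg g' = fullv.
  apply/limg_fullP => w; have : i w \in limg g by rewrite -iE memv_img ?memvf.
  by case/limgP => v; rewrite -g'E => /((lker0_inj i).1 i0) ->; exists v.
have [h rh hE] := projP _ _ _ _ (conj (rhomP g') g'_epi) (rhomP f').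
exists (Rhom rh) => v; rewrite -g'E -f'E; congr (i _).
by rewrite -[in RHS]hE comp_lfunE.
Qed.

Lemma proj_split P M (g : rhom M P) : projective_rmod P -> limg g = fullv ->
  exists h : rhom P M, forall v, g (h v) = v.
Proof.
move=> projP g_epi; have [|h hE] := proj_lift (g := g) (f := rid P) projP.
  by rewrite g_epi subvf.
by exists h => v; rewrite hE ridE.
Qed.

Lemma projP_lift P :
  (forall M N (g : rhom M N) (f : rhom P N), limg g = fullv ->
    exists h : rhom P M, forall v, g (h v) = f v) ->
  projective_rmod P.
Proof.
move=> H M N g f [rg g_epi] rf; have [h hE] := H _ _ (Rhom rg) (Rhom rf) g_epi.
by exists h; [exact: rhomP | apply/lfunP => v; rewrite comp_lfunE -hE].
Qed.

Lemma proj_retract P Q (u : rhom P Q) (w : rhom Q P) :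
  projective_rmod Q -> (forall v, w (u v) = v) -> projective_rmod P.
Proof.
move=> projQ wu; apply: projP_lift => M N g f g_epi.
have [|h hE] := proj_lift (g := g) (f := rcomp f w) projQ.
  by rewrite g_epi subvf.
by exists (rcomp h u) => v; rewrite rcompE hE rcompE wu.
Qed.

Lemma proj_dsum P Q D (i : rhom P D) (j : rhom Q D) (p : rhom D P) (q : rhom D Q) :
  projective_rmod P -> projective_rmod Q ->
  (forall z, z = i (p z) + j (q z)) -> projective_rmod D.
Proof.
move=> projP projQ dec; apply: projP_lift => M N g f g_epi.
have fg (X : rmod A) (x : rhom X N) : (limg x <= limg g)%VS by rewrite g_epi subvf.
have [h hE] := proj_lift (g := g) (f := rcomp f i) projP (fg _ _).
have [k kE] := proj_lift (g := g) (f := rcomp f j) projQ (fg _ _).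
exists (radd (rcomp h p) (rcomp k q)) => v.
by rewrite !rE linearD /= hE kE !rE -linearD -dec.
Qed.

Lemma rmod_isoP M N :
  rmod_iso M N <-> exists f : rhom M N, lker f = 0%VS /\ limg f = fullv.
Proof.
split=> [[f rf ff]|[f ff]]; first by exists (Rhom rf).
by exists f => //; exact: rhomP.
Qed.

Lemma rmod_iso_inv M N (f : rhom M N) : lker f = 0%VS -> limg f = fullv ->
  exists g : rhom N M, (forall v, g (f v) = v) /\ (forall w, f (g w) = w).
Proof.
move=> f0 ff; have [|g gE] := factor_epi (f := rid M) ff; first by rewrite f0 sub0v.
exists g; split=> [v|w]; first by rewrite gE ridE.
by have /limg_fullP/(_ w)[v ->] := ff; rewrite gE ridE.
Qed.

Lemma can_iso M N (f : rhom M N) (g : rhom N M) :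
  (forall v, g (f v) = v) -> (forall w, f (g w) = w) -> rmod_iso M N.
Proof.
move=> gf fg; apply/rmod_isoP; exists f; split; first exact/lker0_inj/(can_inj gf).
by apply/limg_fullP => w; exists (g w).
Qed.

Lemma rmod_iso_refl M : rmod_iso M M.
Proof. by apply: (@can_iso _ _ (rid M) (rid M)) => v; rewrite !rE. Qed.

Lemma rmod_iso_sym M N : rmod_iso M N -> rmod_iso N M.
Proof.
by case/rmod_isoP => f [f0 ff]; have [g [gf fg]] := rmod_iso_inv f0 ff; apply: can_iso fg gf.
Qed.

Lemma rmod_iso_trans M N P : rmod_iso M N -> rmod_iso N P -> rmod_iso M P.
Proof.
case/rmod_isoP => f [f0 ff] /rmod_isoP [g [g0 gg]].
have [f' [ff' f'f]] := rmod_iso_inv f0 ff; have [g' [gg' g'g]] := rmod_iso_inv g0 gg.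
by apply: (@can_iso _ _ (rcomp g f) (rcomp f' g')) => v; rewrite !rE ?gg' ?ff' ?f'f ?g'g.
Qed.

Lemma simple_epi M S (f : rhom M S) :
  simple_rmod S -> limg f <> 0%VS -> limg f = fullv.
Proof. by case=> _ simS f0; case: (simS _ (submod_limg f)). Qed.

Lemma simple_mono M S (f : rhom S M) :
  simple_rmod S -> limg f <> 0%VS -> lker f = 0%VS.
Proof.
case=> _ simS f0; case: (simS _ (submod_ker f)) => // /lkerfP kf.
by case: f0; apply/limg0P.
Qed.

Lemma schur S T (f : rhom S T) :
  simple_rmod S -> simple_rmod T -> limg f <> 0%VS -> rmod_iso S T.
Proof.
move=> sS sT f0; apply/rmod_isoP; exists f.
by split; [apply: simple_mono | apply: simple_epi].
Qed.

Lemma simple_iso S T : simple_rmod S -> rmod_iso S T -> simple_rmod T.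
Proof.
move=> [nzS simS] /rmod_isoP[f [f0 ff]]; split.
  move=> T0; apply: nzS; apply/eqP; rewrite -subv0 -f0.
  apply/subvP => v _; rewrite memv_ker -memv0 -T0; exact: memvf.
move=> U sU; have [/= U0|UT] := simS _ (submod_preim f sU).
  left; apply/eqP; rewrite -subv0; apply/subvP => w wU.
  have /limg_fullP/(_ w)[v def_w] := ff; rewrite memv0 def_w.
  have : v \in (f @^-1: U)%VS by rewrite preimE -def_w.
  by rewrite U0 memv0 => /eqP->; rewrite linear0.
right; apply/subfvP/subvP => w _; have /limg_fullP/(_ w)[v ->] := ff.
by rewrite -preimE UT memvf.
Qed.

Lemma simple_sub M (W : {vspace M}) : is_submod W -> W <> 0%VS ->
  exists S (i : rhom S M), [/\ simple_rmod S, lker i = 0%VS & (limg i <= W)%VS].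
Proof.
move=> sW nzW.
have [U [[sU nzU] UW min]] :=
  min_vspace (Q := fun U : {vspace M} => is_submod U /\ U <> 0%VS) (conj sW nzW).
have [S [i [i0 iU]]] := sub_exists sU; exists S, i; split=> //; last by rewrite iU.
have i_inj := (lker0_inj i).1 i0.
split=> [S0|V sV]; first by apply: nzU; rewrite -iU S0 limg0.
have [V0|nzV] := pselect (V = 0%VS); [by left | right].
have: (i @: V)%VS = (i @: fullv)%VS.
  rewrite iU; apply: min; last by rewrite -iU; apply/limgS/subvf.
  split; first exact: submod_img.
  by move/eqP; rewrite -(limg0 i) eq_limg_ker0 ?i0 // => /eqP.
by move/eqP; rewrite eq_limg_ker0 ?i0 // => /eqP.
Qed.

Lemma simple_quo M (W : {vspace M}) : is_submod W -> W <> fullv ->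
  exists S (q : rhom M S), [/\ simple_rmod S, limg q = fullv & (W <= lker q)%VS].
Proof.
move=> sW nzW.
have [U [[sU nzU] UW max]] :=
  max_vspace (Q := fun U : {vspace M} => is_submod U /\ U <> fullv) (conj sW nzW).
have [S [q [qf qU]]] := quo_exists sU; exists S, q; split=> //; last by rewrite qU.
split=> [S0|V sV].
  by apply: nzU; rewrite -qU; apply/lkerfP/limg0P; rewrite qf.
have [Vf|nfV] := pselect (V = fullv); [by right | left].
have pVU: (q @^-1: V)%VS = U.
  apply: max.
    split; [exact: submod_preim | move=> pf; apply: nfV].
    apply/subfvP/subvP => w _; have /limg_fullP/(_ w)[v ->] := qf.
    by rewrite -preimE pf memvf.
  by apply/subvP => v; rewrite -qU memv_ker preimE => /eqP->; rewrite mem0v.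
apply/eqP; rewrite -subv0; apply/subvP => w.
have /limg_fullP/(_ w)[v ->] := qf.
by rewrite -preimE pVU -qU memv_ker memv0.
Qed.

(** As [S] is simple, [U] is either killed by [p] or maps onto [S]; in the second case [U + lker p]
    is everything and the cover property gives [U = fullv]. Thus [lker p] is the radical. *)
Lemma cover_radical P S (p : 'Hom(P, S)) (U : {vspace P}) :
  simple_rmod S -> projective_cover p -> is_submod U -> U <> fullv ->
  (U <= lker p)%VS.
Proof.
move=> sS [_ [rp pf] cov] sU nfU.
have [/eqP|pU] := sS.2 _ (submod_img (Rhom rp) sU); first by rewrite -lkerE.
case: nfU; apply: cov => //; apply/subfvP/subvP => v _.
have : p v \in (p @: U)%VS by rewrite [(p @: U)%VS]pU memvf.
case/memv_imgP => u uU puv; rewrite -(subrK u v) addrC memv_add //.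
by rewrite memv_ker linearB /= puv subrr.
Qed.

Lemma cover_ker_proper P S (p : 'Hom(P, S)) :
  simple_rmod S -> projective_cover p -> lker p <> fullv.
Proof.
move=> [nzS _] [_ [_ pf] _] /lkerfP p0; apply: nzS.
by rewrite -pf; apply/limg0P.
Qed.

Lemma cover_indec P S (p : 'Hom(P, S)) :
  simple_rmod S -> projective_cover p -> indecomposable_rmod P.
Proof.
move=> sS cp; have npf := cover_ker_proper sS cp; split=> [P0|U V sU sV UV UcV].
  by apply: npf; apply/subfvP; rewrite P0 sub0v.
have [Uf|nfU] := pselect (U = fullv).
  by right; move: UcV; rewrite Uf capfv.
have [Vf|nfV] := pselect (V = fullv).
  by left; move: UcV; rewrite Vf capvf.
case: npf; apply/subfvP; rewrite -UV subv_add.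
by rewrite !(cover_radical sS cp).
Qed.

Lemma cover_top P S (p : 'Hom(P, S)) T (f : rhom P T) :
  simple_rmod S -> projective_cover p -> simple_rmod T -> limg f <> 0%VS ->
  rmod_iso S T.
Proof.
move=> sS cp sT nzf; have [_ [rp pf] _] := cp.
have kfp : (lker f <= lker p)%VS.
  apply: (cover_radical sS cp (submod_ker f)) => /lkerfP f0.
  by apply: nzf; apply/limg0P.
have [h hE] := factor_epi (f := Rhom rp) (simple_epi sT nzf) kfp.
apply: rmod_iso_sym; apply: (schur (f := h)) => // /limg0P h0.
apply: sS.1; rewrite -pf; apply/limg0P => v.
by have /= <- := hE v; rewrite h0.
Qed.

(** Source of the factors in the explicit filtrations below: [h] descends along [g] to the submodule
    [limg g], and what it kills there is the image of its kernel. *)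
Lemma factor_iso_cover P M N (g : rhom P M) (h : rhom P N) :
  limg h = fullv -> (lker g <= lker h)%VS ->
  factor_iso (g @: lker h)%VS (limg g) N.
Proof.
move=> h_epi gh; pose f := (h \o g^-1)%VF; exists f.
have fE v : f (g v) = h v.
  rewrite comp_lfunE; apply/eqP; rewrite -subr_eq0 -linearB -memv_ker.
  by apply: (subvP gh); rewrite memv_ker linearB /= limg_lfunVK ?subrr ?memv_img ?memvf.
split=> [a _ /limgP[v ->]|||].
- by rewrite -rhom_act !fE rhom_act.
- apply/subfvP/subvP => w _; have /limg_fullP/(_ w)[v ->] := h_epi.
  by rewrite -fE memv_img // memv_img ?memvf.
- exact/limgS/subvf.
apply/vspaceP => w; rewrite memv_cap; apply/andP/memv_imgP.
  case=> /limgP[v ->]; rewrite memv_ker fE => /eqP hv.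
  by exists v => //; rewrite memv_ker hv.
case=> v; rewrite memv_ker => /eqP hv ->.
by rewrite memv_img ?memvf // memv_ker fE hv.
Qed.

End ProjectiveSimple.

(** * Uniserial modules *)

Section Uniserial.
Variables (K : fieldType) (A : falgType K).
Implicit Types M N P S T : rmod A.

(** A composition chain starting at an arbitrary [U], so that chains can be concatenated. *)
Fixpoint simple_chain M (U : {vspace M}) (s : seq {vspace M}) : Prop :=
  if s is V :: s' then
    [/\ is_submod V, exists2 N : rmod A, simple_rmod N & factor_iso U V N
      & simple_chain V s']
  else True.

Lemma simple_chain_cat M (U : {vspace M}) s t :
  simple_chain U s -> simple_chain (last U s) t -> simple_chain U (s ++ t).
Proof. by elim: s U => //= V s IH U [sV fV /IH{}IH /IH]. Qed.

Lemma simple_chainP M (U : {vspace M}) s : simple_chain U s ->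
  (forall V, V \in s -> is_submod V) /\
  forall i, (i < size s)%N -> exists2 N : rmod A, simple_rmod N &
     factor_iso (nth 0%VS (U :: s) i) (nth 0%VS s i) N.
Proof.
elim: s U => //= V s IH U [sV fV /IH[subs facs]]; split=> [W|[|i]] //.
  by rewrite inE => /predU1P[->|/subs].
by rewrite ltnS => /facs.
Qed.

Lemma simple_chain_exists M (U W : {vspace M}) : is_submod U -> is_submod W ->
  (U <= W)%VS -> exists2 s, simple_chain U s & last U s = W.
Proof.
have [n] := ubnP (\dim W - \dim U); elim: n U => // n IH U ltn sU sW UW.
have [->|neUW] := pselect (U = W); first by exists [::].
have [V [[sV UV neUV] VW min]] := min_vspace
  (Q := fun V : {vspace M} => [/\ is_submod V, (U <= V)%VS & U <> V])
  (And3 sW UW neUW).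
have [|s cs ls] := IH V _ sV sW VW.
  rewrite ltnS in ltn; apply: leq_trans ltn.
  have ltUV : (\dim U < \dim V)%N.
    by rewrite ltnNge; apply/negP => le; apply/neUV/eqP; rewrite eqEdim UV.
  by rewrite ltn_sub2l // (leq_trans ltUV) // dimvS.
exists (V :: s) => //; split=> //.
have [N [i [i0 iV]]] := sub_exists sV.
have [T [q [qf qU]]] := quo_exists (submod_preim i sU).
have UE : (i @: lker q)%VS = U.
  rewrite qU; apply/vspaceP => v; apply/memv_imgP/idP => [[u]|vU].
    by rewrite preimE => ? ->.
  have : v \in limg i by rewrite iV (subvP UV).
  by case/limgP => u def_v; exists u => //; rewrite preimE -def_v.
exists T; last by rewrite -UE -iV; apply: factor_iso_cover; rewrite ?i0 ?sub0v.
split=> [T0|X sX].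
  have qN : lker q = fullv by apply/lkerfP/limg0P; rewrite qf.
  by apply: neUV; rewrite -UE qN iV.
pose Y := (i @: (q @^-1: X))%VS.
have sY : is_submod Y by apply/submod_img/submod_preim.
have UY : (U <= Y)%VS.
  rewrite -UE; apply: limgS; apply/subvP => v.
  by rewrite preimE memv_ker => /eqP->; rewrite mem0v.
have YV : (Y <= V)%VS by rewrite -iV; apply/limgS/subvf.
have i_inj := (lker0_inj i).1 i0.
have [eqUY|neUY] := pselect (U = Y).
  left; apply/eqP; rewrite -subv0; apply/subvP => w wX.
  have /limg_fullP/(_ w)[v def_w] := qf.
  have : i v \in U by rewrite eqUY memv_img // preimE -def_w.
  by rewrite -preimE -qU memv_ker -def_w memv0.
right; apply/subfvP/subvP => w _; have /limg_fullP/(_ w)[v ->] := qf.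
have : i v \in Y by rewrite (min Y) // -iV memv_img ?memvf.
by case/memv_imgP => u uX /i_inj ->; rewrite -preimE.
Qed.

(* For a uniserial module, c is the length and R k the k-th radical power. *)
Definition radical_series M (c : nat) (R : nat -> {vspace M}) : Prop :=
  [/\ R 0%N = fullv, forall k, is_submod (R k),
      forall k, (c <= k)%N -> R k = 0%VS,
      forall k, (k < c)%N -> (R k.+1 <= R k)%VS /\ R k.+1 <> R k
    & forall U, is_submod U -> exists k, U = R k].

Lemma uniserial_radical_series M : uniserial M -> exists c R, @radical_series M c R.
Proof.
case=> s [[sE ssub sfac] suniq].
pose W i := nth 0%VS (0%VS :: s) i.
have Wmem i : is_submod (W i).
  rewrite /W; case: i => [|i] /=; first exact: submod0.
  have [lt|le] := ltnP i (size s); first exact/ssub/mem_nth.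
  by rewrite nth_default //; exact: submod0.
exists (size s), (fun k => W (size s - k)%N); split=> //.
- by rewrite subn0 /W -sE; rewrite -(last_nth 0%VS).
- by move=> k; rewrite -subn_eq0 => /eqP->.
- move=> k ltk; have [|N [nzN _] [f [_ ff UV Uk]]] := sfac (size s - k.+1)%N.
    by rewrite ltn_subrL (leq_trans _ ltk).
  have eW : nth 0%VS s (size s - k.+1) = W (size s - k)%N.
    by rewrite /W -[in RHS](subnSK ltk).
  rewrite -/(W _) eW in ff UV Uk; split=> // eqW; apply: nzN.
  rewrite -ff; apply/eqP; rewrite -lkerE; apply/capv_idPl.
  by rewrite Uk eqW.
move=> U sU.
have [s1 c1 l1] := simple_chain_exists (@submod0 _ _ M) sU (sub0v _).
have [s2 c2 l2] := simple_chain_exists sU (@submodf _ _ M) (subvf _).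
have cE : s = s1 ++ s2.
  apply: suniq.
  have [sub fac] := simple_chainP (simple_chain_cat c1 (eq_rect_r (fun V => simple_chain V s2) c2 l1)).
  by split=> //; rewrite last_cat l1 l2.
exists (size s2); rewrite cE size_cat addnK /W cE -l1 -cat_cons nth_cat /=.
by rewrite ltnSn -last_nth.
Qed.

Section RadicalSeries.
Variables (M : rmod A) (c : nat) (R : nat -> {vspace M}).
Hypothesis MR : radical_series c R.

Lemma rs0 : R 0%N = fullv. Proof. by case: MR. Qed.
Lemma rs_submod k : is_submod (M := M) (R k). Proof. by case: MR. Qed.
Lemma rs_ge k : (c <= k)%N -> R k = 0%VS. Proof. by case: MR => _ _ + _ _; apply. Qed.

Lemma rs_mono j k : (j <= k)%N -> (R k <= R j)%VS.
Proof.
move=> /subnK<-; elim: (k - j)%N => [|i IH] //; rewrite addSn.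
apply: subv_trans IH; have [le|lt] := leqP c (i + j)%N.
  by rewrite rs_ge ?sub0v // leqW.
by have [_ _ _ /(_ _ lt)[]] := MR.
Qed.

Lemma rs_lt j k : (j < k)%N -> (j < c)%N -> ~~ (R j <= R k)%VS.
Proof.
move=> ltjk ltjc; apply/negP => le; have [_ _ _ /(_ _ ltjc)[le1 ne] _] := MR.
by apply/ne/eqP; rewrite eqEsubv le1 (subv_trans le) // rs_mono.
Qed.

Lemma rs_eq0 k : (R k == 0%VS) = (c <= k)%N.
Proof.
apply/eqP/idP => [R0|]; last exact: rs_ge.
by rewrite leqNgt; apply/negP => lt; have := rs_lt (ltnSn k) lt; rewrite R0 sub0v.
Qed.

Lemma rs_sub j k : (R k <= R j)%VS = (j <= k)%N || (c <= k)%N.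
Proof.
have [lejk|ltkj] := leqP j k => /=; first exact: rs_mono.
have [le|lt] := leqP c k; first by rewrite rs_ge ?sub0v.
by apply/negbTE/rs_lt.
Qed.

Lemma rs_eq j k : (j <= c)%N -> (k <= c)%N -> R j = R k -> j = k.
Proof.
move=> jc kc eqR; have: (R k <= R j)%VS && (R j <= R k)%VS by rewrite eqR subvv.
rewrite !rs_sub => /andP[/orP H1 /orP H2]; apply/eqP; rewrite eqn_leq.
apply/andP; split; [case: H1 | case: H2] => // le; exact: leq_trans le.
Qed.

Lemma rs_ex (U : {vspace M}) : is_submod U -> exists2 k, (k <= c)%N & U = R k.
Proof.
move=> sU; have [_ _ _ _ /(_ _ sU)[k ->]] := MR.
have [le|lt] := leqP k c; first by exists k.
by exists c => //; rewrite !rs_ge // ltnW.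
Qed.

Lemma rs_next (U : {vspace M}) k : is_submod U -> (U <= R k)%VS -> U <> R k -> (U <= R k.+1)%VS.
Proof.
move=> sU; have [j jc ->] := rs_ex sU; rewrite !rs_sub => /orP[le|->]; last by rewrite orbT.
by rewrite leq_eqVlt in le; case/orP: le => [/eqP->|->].
Qed.

Lemma rs_total (U V : {vspace M}) : is_submod U -> is_submod V -> (U <= V)%VS \/ (V <= U)%VS.
Proof.
move=> sU sV; have [j _ ->] := rs_ex sU; have [k _ ->] := rs_ex sV.
by have [le|/ltnW le] := leqP j k; [right | left]; apply: rs_mono.
Qed.

End RadicalSeries.

Section RadicalMorphism.
Variables (P M : rmod A) (c d : nat) (Q : nat -> {vspace P}) (R : nat -> {vspace M}).
Hypotheses (PQ : radical_series d Q) (MR : radical_series c R).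
Variables (f : rhom P M) (k : nat).
Hypothesis fk : limg f = R k.

(** In a uniserial module each term contains every proper submodule of the previous one. A map that
    does not vanish on [Q t] therefore carries the largest proper submodule of [Q t] to that of its
    image. *)
Lemma rs_img t : (f @: Q t)%VS = R (k + t).
Proof.
elim: t => [|t IH]; first by rewrite (rs0 PQ) addn0.
have [le|lt] := leqP c (k + t).
  apply/eqP; rewrite (rs_ge MR (k := k + t.+1)) ?addnS ?leqW // -subv0.
  by rewrite -(rs_ge MR le) -IH limgS // (rs_mono PQ).
have [sQ sR] := (rs_submod PQ, rs_submod MR).
have nzR : R (k + t) <> 0%VS by move/eqP; rewrite (rs_eq0 MR) leqNgt lt.
have nzQ : Q t <> 0%VS by move=> Qt0; apply: (nzR); rewrite -IH Qt0 limg0.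
have ltd : (t < d)%N by rewrite ltnNge -(rs_eq0 PQ); apply/eqP.
rewrite addnS; apply: subv_anti; apply/andP; split.
  apply: (rs_next MR); [exact: submod_img | by rewrite -IH limgS ?(rs_mono PQ) |].
  move=> eqR; apply: (nzR); apply/eqP; rewrite -IH -lkerE.
  have [le|//] := rs_total PQ (submod_ker f) (sQ t).
  have le1 : (lker f <= Q t.+1)%VS.
    apply: (rs_next PQ) => //; first exact: submod_ker.
    by move=> eqK; apply: (nzR); rewrite -IH -eqK; apply/eqP; rewrite -lkerE.
  have /negP[] := rs_lt PQ (ltnSn t) ltd.
  apply/subvP => v vQ; have : f v \in (f @: Q t.+1)%VS by rewrite eqR -IH memv_img.
  case/memv_imgP => u uQ fvu; rewrite -(subrK u v) memvD //.
  by apply: (subvP le1); rewrite memv_ker linearB /= fvu subrr.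
apply/subvP => w wR.
have : w \in (f @: Q t)%VS by rewrite IH (subvP (rs_mono MR (leqnSn _))).
case/memv_imgP => v vQ def_w; rewrite def_w; apply: memv_img.
suff le : (Q t :&: f @^-1: R (k + t).+1 <= Q t.+1)%VS.
  by apply: (subvP le); rewrite memv_cap vQ preimE -def_w.
apply: (rs_next PQ); [by apply/submodI/submod_preim | exact: capvSl |].
move/capv_idPl => le; have /negP[] := rs_lt MR (ltnSn (k + t)) lt.
apply/subvP => x; rewrite -IH => /memv_imgP[u uQ ->].
by rewrite -preimE (subvP le).
Qed.

(** By [rs_img], [f] kills exactly the layers pushed below depth [c]. The length bound is what later
    makes the Kupisch function nondecreasing. *)
Lemma rs_ker : (k <= c)%N -> lker f = Q (c - k) /\ (c <= k + d)%N.
Proof.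
move=> lekc; have cd : (c <= k + d)%N.
  by rewrite -(rs_eq0 MR) -rs_img (rs_ge PQ) // limg0.
split=> //; have [m md kE] := rs_ex PQ (submod_ker f).
have QkerE t : (Q t <= lker f)%VS = (c <= k + t)%N.
  by rewrite lkerE rs_img (rs_eq0 MR).
rewrite kE; congr Q; apply/eqP; rewrite eqn_leq leq_subLR -QkerE kE subvv andbT.
have := QkerE (c - k)%N; rewrite subnKC // leqnn kE (rs_sub PQ) => /orP[//|le].
exact: leq_trans md le.
Qed.

End RadicalMorphism.
End Uniserial.

(** * Projective dimension *)

Section RegularModule.
Variables (K : fieldType) (A : falgType K).
Implicit Types M N P : rmod A.

Lemma amulr_linear : linear (@amulr K A).
Proof. by move=> k a b; rewrite linearD linearZ. Qed.

Lemma amulr1 : amulr (1 : A) = \1%VF.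
Proof. by apply/lfunP => v; rewrite lfunE id_lfunE /= mulr1. Qed.

Lemma amulrM (a b : A) : amulr (a * b) = (amulr b \o amulr a)%VF.
Proof. by apply/lfunP => v; rewrite comp_lfunE !lfunE /= mulrA. Qed.

Definition regmod : rmod A := RMod amulr_linear amulr1 amulrM.

Lemma regmodE (a : A) (v : regmod) : ract regmod a v = (v : A) * a.
Proof. by rewrite lfunE. Qed.

Lemma regmod_hom M (m : M) : exists h : rhom regmod M, forall a : A, h a = ract M a m.
Proof.
have hl : linear (fun a : A => ract M a m).
  by move=> k a b; rewrite ract_linear add_lfunE scale_lfunE.
pose fl := GRing.isLinear.Build K A M *:%R _ hl.
pose ff : {linear A -> M} := HB.pack (fun a : A => ract M a m) fl.
have hE a : (linfun ff : 'Hom(A, M)) a = ract M a m by rewrite lfunE.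
have rh : @is_rhom _ _ regmod M (linfun ff).
  by move=> a v; rewrite regmodE !hE ractE.
by exists (Rhom rh).
Qed.

Lemma ract_id M (m : M) : ract M 1 m = m.
Proof. by rewrite ract1 id_lfunE. Qed.

Lemma regmod_proj : projective_rmod regmod.
Proof.
apply: projP_lift => M N g f /limg_fullP/(_ (f (1 : A)))[m fm].
have [h hE] := regmod_hom m; exists h => a.
by rewrite hE rhom_act -fm -rhom_act regmodE mul1r.
Qed.

Lemma enough_proj M : exists P (g : rhom P M), projective_rmod P /\ limg g = fullv.
Proof.
pose Q (U : {vspace M}) := exists P (g : rhom P M), projective_rmod P /\ limg g = U.
have [h0 _] := regmod_hom (0 : M).
have Qh0 : Q (limg h0) by exists regmod, h0; split; [exact: regmod_proj |].
have [U [[P [g [projP <-]]] _ max]] := max_vspace Qh0.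
exists P, g; split=> //; apply/limg_fullP => m.
have [h hE] := regmod_hom m.
have [D [i [j [p [q [pi qj qi pj dec]]]]]] := dsum_exists P regmod.
pose gh := radd (rcomp g p) (rcomp h q).
have Qgh : Q (limg gh).
  by exists D, gh; split=> //; apply: proj_dsum dec => //; exact: regmod_proj.
have le : (limg g <= limg gh)%VS.
  apply/subvP => _ /limgP[v ->]; apply/limgP; exists (i v).
  by rewrite !rE pi qi linear0 addr0.
apply/limgP; rewrite -(max _ Qgh le); apply/limgP; exists (j (1 : A)).
by rewrite !rE pj qj linear0 add0r hE ract_id.
Qed.

Lemma regmod_neq0 : rmod_nonzero regmod.
Proof.
move=> A0; have /eqP := oner_neq0 A; apply.
by apply/eqP; rewrite -memv0 -A0 memvf.
Qed.

End RegularModule.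

Section ProjectiveDimension.
Variables (K : fieldType) (A : falgType K).
Implicit Types M N P Q : rmod A.

(** Bounded projective dimension through one projective presentation per step, suited to induction
    on syzygies; [pdim_leP] identifies it with [pdim_le]. *)
Fixpoint pd n M : Prop :=
  if n is m.+1 then
    exists P (g : rhom P M) N (i : rhom N P),
      [/\ projective_rmod P, limg g = fullv, lker i = 0%VS, limg i = lker g & pd m N]
  else projective_rmod M.

Lemma zero_proj M : (fullv : {vspace M}) = 0%VS -> projective_rmod M.
Proof.
move=> M0; apply: projP_lift => X Y g f _; exists (rzero M X) => v.
have -> : v = 0 by apply/eqP; rewrite -memv0 -M0 memvf.
by rewrite rzeroE !linear0.
Qed.

Lemma nonzeroPn M : ~ rmod_nonzero M <-> (fullv : {vspace M}) = 0%VS.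
Proof. by split=> [/contrapT|M0 /(_ M0)]. Qed.

(* Stably a direct summand; this spares the direct sums in Schanuel's lemma. *)
Definition stable_retract M M' : Prop :=
  exists Q (u : rhom M M') (w : rhom M' M) (a : rhom M Q) (b : rhom Q M),
    projective_rmod Q /\ forall x, x = w (u x) + b (a x).

Lemma stable_retract_id M M' (u : rhom M M') (w : rhom M' M) :
  (forall x, w (u x) = x) -> stable_retract M M'.
Proof.
move=> wu; exists (regmod A), u, w, (rzero _ _), (rzero _ _).
by split=> [|x]; [exact: regmod_proj | rewrite wu rzeroE addr0].
Qed.

(** Lift [u], [w], [b] to maps [U], [W], [B] of projectives. The difference [e] between the identity
    of [P] and [W U + B a g] lands in [lker g], so the identity of [N] is a map through [N'] plus
    one through the projective [P]. *)
Lemma stable_retract_syz M M' P P' N N'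
    (g : rhom P M) (i : rhom N P) (g' : rhom P' M') (i' : rhom N' P') :
  projective_rmod P -> limg g = fullv -> lker i = 0%VS -> limg i = lker g ->
  projective_rmod P' -> limg g' = fullv -> lker i' = 0%VS -> limg i' = lker g' ->
  stable_retract M M' -> stable_retract N N'.
Proof.
move=> pP gf i0 ig pP' gf' i0' ig' [Q [u [w [a [b [pQ uw]]]]]].
have [|U UE] := proj_lift (g := g') (f := rcomp u g) pP; first by rewrite gf' subvf.
have [|W WE] := proj_lift (g := g) (f := rcomp w g') pP'; first by rewrite gf subvf.
have [|B BE] := proj_lift (g := g) (f := b) pQ; first by rewrite gf subvf.
have gi x : g (i x) = 0.
  by apply/eqP; rewrite -memv_ker -ig memv_img ?memvf.
have gi' x : g' (i' x) = 0.
  by apply/eqP; rewrite -memv_ker -ig' memv_img ?memvf.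
have [|n nE] := factor_mono i0' (f := rcomp U i).
  by rewrite ig'; apply/limg_subP => x; rewrite memv_ker rcompE UE rcompE gi linear0.
have [|m mE] := factor_mono i0 (f := rcomp W i').
  by rewrite ig; apply/limg_subP => x; rewrite memv_ker rcompE WE rcompE gi' linear0.
pose e := radd (rid P) (ropp (radd (rcomp W U) (rcomp B (rcomp a g)))).
have eE x : e x = x - (W (U x) + B (a (g x))) by rewrite !rE.
have [|c cE] := factor_mono i0 (f := e).
  rewrite ig; apply/limg_subP => x; rewrite memv_ker eE linearB linearD /= WE BE.
  by rewrite !rE UE rcompE -uw subrr.
exists P, n, m, i, c; split=> // x; apply: ((lker0_inj i).1 i0).
by rewrite linearD /= mE cE !rE nE !rE gi !linear0 addr0 addrC subrK.
Qed.

Lemma pd_stable_retract n M M' : stable_retract M M' -> pd n M' -> pd n M.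
Proof.
elim: n M M' => [|n IH] M M' sr /=.
  have [Q [u [w [a [b [pQ uw]]]]]] := sr => pM'.
  apply: projP_lift => X Y g f gf.
  have [|h hE] := proj_lift (g := g) (f := rcomp f w) pM'; first by rewrite gf subvf.
  have [|k kE] := proj_lift (g := g) (f := rcomp f b) pQ; first by rewrite gf subvf.
  exists (radd (rcomp h u) (rcomp k a)) => x.
  by rewrite !rE linearD /= hE kE !rE -linearD -uw.
case=> P' [g' [N' [i' [pP' gf' i0' ig' pdN']]]].
have [P [g [pP gf]]] := enough_proj M.
have [N [i [i0 ig]]] := sub_exists (submod_ker g).
exists P, g, N, i; split=> //; apply: IH pdN'.
exact: stable_retract_syz pP gf i0 ig pP' gf' i0' ig' sr.
Qed.

Lemma pd_iso n M M' : rmod_iso M M' -> pd n M -> pd n M'.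
Proof.
move=> /rmod_isoP[f [f0 ff]]; have [g [gf fg]] := rmod_iso_inv f0 ff.
exact: pd_stable_retract (stable_retract_id fg).
Qed.

Lemma pd_schanuel n M P N (g : rhom P M) (i : rhom N P) :
  projective_rmod P -> limg g = fullv -> lker i = 0%VS -> limg i = lker g ->
  pd n.+1 M -> pd n N.
Proof.
move=> pP gf i0 ig [P' [g' [N' [i' [pP' gf' i0' ig' pdN']]]]].
apply: pd_stable_retract pdN'; apply: (stable_retract_syz pP gf i0 ig pP' gf' i0' ig').
by apply: (@stable_retract_id _ _ (rid M) (rid M)) => x; rewrite !rE.
Qed.

Lemma pd_succ n M : pd n M -> pd n.+1 M.
Proof.
elim: n M => [|n IH] M; last first.
  by case=> P [g [N [i [pP gf i0 ig /IH pdN]]]]; exists P, g, N, i.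
move=> pM; have [Z [i [i0 iz]]] := sub_exists (@submod0 _ _ M).
exists M, (rid M), Z, i; split=> //; first by apply/limg_fullP => x; exists x; rewrite ridE.
  by rewrite iz; apply/esym/lker0_inj => x y; rewrite !ridE.
apply/zero_proj/eqP; rewrite -subv0; apply/subvP => z _.
rewrite memv0; apply/eqP/((lker0_inj i).1 i0).
by rewrite linear0; exact: (limg0P i).1 iz z.
Qed.

Lemma pd_leq m n M : (m <= n)%N -> pd m M -> pd n M.
Proof. by move=> /subnK<-; elim: (n - m)%N => // k IH /IH; exact: pd_succ. Qed.

(** At stage 0 the sequence splits, so [M] is [M'] up to the projective [M'']. Afterwards [P'] and
    [P''] together cover [M], using a lift [t] of [g''] along [p], and the syzygies form a short
    exact sequence again. *)
Lemma pd_horseshoe n M' M M'' (i : rhom M' M) (p : rhom M M'') :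
  lker i = 0%VS -> limg i = lker p -> limg p = fullv ->
  pd n M' -> pd n M'' -> pd n M.
Proof.
elim: n M' M M'' i p => [|n IH] M' M M'' i p i0 ip pf.
  move=> pdM' pdM''; have [s ps] := proj_split pdM'' pf.
  have [|u uE] := factor_mono i0 (f := radd (rid M) (ropp (rcomp s p))).
    rewrite ip; apply/limg_subP => x; rewrite memv_ker !rE linearB /= ps subrr //.
  apply: (@pd_stable_retract 0 _ M') pdM'; exists M'', u, i, p, s; split=> // x.
  by rewrite uE !rE subrK.
case=> P' [g' [N' [j' [pP' gf' j0' jg' pdN']]]].
case=> P'' [g'' [N'' [j'' [pP'' gf'' j0'' jg'' pdN'']]]].
have [|t tE] := proj_lift (g := p) (f := g'') pP''; first by rewrite pf subvf.
have [D [i1 [i2 [p1 [p2 [p1i p2i p2i1 p1i2 dec]]]]]] := dsum_exists P' P''.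
have pip x : p (i x) = 0.
  by apply/eqP; rewrite -memv_ker -ip memv_img ?memvf.
pose g := radd (rcomp (rcomp i g') p1) (rcomp t p2).
have gE z : g z = i (g' (p1 z)) + t (p2 z) by rewrite !rE.
have pgE z : p (g z) = g'' (p2 z) by rewrite gE linearD /= pip add0r tE.
have [N [j [j0 jg]]] := sub_exists (submod_ker g).
have j_inj := (lker0_inj j).1 j0.
have j'_inj := (lker0_inj j').1 j0'.
have j''_inj := (lker0_inj j'').1 j0''.
exists D, g, N, j; split=> //; first exact: proj_dsum dec.
  apply/limg_fullP => m; have /limg_fullP/(_ (p m))[x'' def_pm] := gf''.
  have : m - t x'' \in limg i.
    by rewrite ip memv_ker linearB /= tE def_pm subrr.
  case/limgP => m' def_m; have /limg_fullP/(_ m')[x' def_m'] := gf'.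
  exists (i1 x' + i2 x''); rewrite gE !linearD /= p1i p1i2 p2i1 p2i !linear0 addr0 add0r.
  by rewrite -def_m' -def_m subrK.
have [|a aE] := factor_mono j0 (f := rcomp i1 j').
  rewrite jg; apply/limg_subP => x; rewrite memv_ker gE !rE p1i p2i1 linear0 addr0.
  have /eqP-> : g' (j' x) == 0 by rewrite -memv_ker -jg' memv_img ?memvf.
  by rewrite linear0.
have [|b bE] := factor_mono j0'' (f := rcomp p2 j).
  rewrite jg''; apply/limg_subP => x; rewrite memv_ker !rE -pgE.
  have /eqP-> : g (j x) == 0 by rewrite -memv_ker -jg memv_img ?memvf.
  by rewrite linear0.
apply: (IH _ _ _ a b) => //.
- apply/lker0_inj => x y /(congr1 (fun z => p1 (j z))).
  by rewrite !aE !rE !p1i => /j'_inj.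
- apply/vspaceP => x; rewrite memv_ker -(inj_eq j''_inj) bE rE linear0.
  apply/limgP/eqP => [[y ->]|p2jx]; first by rewrite aE rE p2i1.
  have : p1 (j x) \in limg j'.
    rewrite jg' memv_ker -(inj_eq ((lker0_inj i).1 i0)) linear0.
    have : g (j x) == 0 by rewrite -memv_ker -jg memv_img ?memvf.
    by rewrite gE p2jx linear0 addr0.
  case/limgP => y def_y; exists y; apply: j_inj.
  by rewrite aE rE -def_y [LHS]dec p2jx linear0 addr0.
apply/limg_fullP => y''.
have : t (j'' y'') \in limg i.
  by rewrite ip memv_ker tE -memv_ker -jg'' memv_img ?memvf.
case/limgP => m' def_m'; have /limg_fullP/(_ m')[x' def_x'] := gf'.
have : i2 (j'' y'') - i1 x' \in limg j.
  rewrite jg memv_ker gE.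
  have -> : p1 (i2 (j'' y'') - i1 x') = - x' by rewrite linearB /= p1i2 p1i sub0r.
  have -> : p2 (i2 (j'' y'') - i1 x') = j'' y'' by rewrite linearB /= p2i p2i1 subr0.
  by rewrite def_m' def_x' !linearN addNr.
case/limgP => x def_x; exists x; apply: j''_inj.
by rewrite bE rE -def_x linearB /= p2i p2i1 subr0.
Qed.

Lemma pd_pdim_le n M : pd n M -> pdim_le M n.
Proof.
elim: n M => [|n IH] M.
  move=> pM; have [Z [i [i0 iz]]] := sub_exists (@submod0 _ _ M).
  have Z0 : (fullv : {vspace Z}) = 0%VS.
    apply/eqP; rewrite -subv0; apply/subvP => z _.
    rewrite memv0; apply/eqP/((lker0_inj i).1 i0).
    by rewrite linear0; exact: (limg0P i).1 iz z.
  pose Pr k : rmod A := if k is _.+1 then Z else M.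
  pose d k : 'Hom(Pr k.+1, Pr k) :=
    match k with 0 => rlf i | _.+1 => rlf (rzero Z Z) end.
  exists Pr, d, (rid M).
  split; last by case=> // k _; apply/nonzeroPn.
  split=> [[|k]|[|k]|||[|k]] //.
  - exact: zero_proj.
  - exact: rhomP.
  - exact: rhomP.
  - by split; [exact: rhomP | apply/limg_fullP => x; exists x; rewrite ridE].
  - by rewrite iz; apply/esym/lker0_inj => x y; rewrite !ridE.
  - by rewrite /= i0; apply/limg0P => z; rewrite rzeroE.
  rewrite /= (_ : lker _ = fullv); last by apply/lkerfP => z; rewrite rzeroE.
  by rewrite [RHS]Z0; apply/(limg0P (rzero Z Z)) => z; rewrite rzeroE.
case=> P0 [g [N [i [pP gf i0 ig /IH[P [d [e [[pPs rd [re ef] de dd] Pn]]]]]]]].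
pose Pr k : rmod A := if k is k'.+1 then P k' else P0.
pose dr k : 'Hom(Pr k.+1, Pr k) :=
  match k with 0 => (rlf i \o e)%VF | k'.+1 => d k' end.
exists Pr, dr, g.
split; last by case=> // k; rewrite ltnS; exact: Pn.
split=> [[|k]|[|k]|||[|k]] //=.
- exact: rcomp_subproof i (Rhom re).
- by split; [exact: rhomP |].
- by rewrite limg_comp ef.
by rewrite de; apply/vspaceP => x; rewrite !memv_ker comp_lfunE -(inj_eq ((lker0_inj i).1 i0)) linear0.
Qed.

Lemma pdim_leP n M : pdim_le M n <-> pd n M.
Proof.
split; last exact: pd_pdim_le.
elim: n M => [|n IH] M [P [d [e [[pP rd [re ef] de dd] Pn]]]].
  have e0 : lker e = 0%VS.
    rewrite -de; apply/(@limg0P _ _ (P 1%N) (P 0%N)) => v; have /nonzeroPn P10 := Pn 1%N isT.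
    by have -> : v = 0; [apply/eqP; rewrite -memv0 -P10 memvf | rewrite linear0].
  have [g [_ eg]] := rmod_iso_inv (f := Rhom re) e0 ef.
  exact: (proj_retract (pP 0%N) eg).
have [N [i [i0 ie]]] := sub_exists (submod_ker (Rhom re)).
exists (P 0%N), (Rhom re), N, i; split=> //; apply: IH.
have [|e' e'E] := factor_mono i0 (f := Rhom (rd 0%N)); first by rewrite ie /= de.
exists (fun k => P k.+1), (fun k => d k.+1), e'; split; last by move=> k ltk; exact: Pn.
split=> //.
  split; first exact: rhomP.
  apply/limg_fullP => x; have : i x \in limg (d 0%N).
    by rewrite de -[lker e]ie memv_img ?memvf.
  by case/(@limgP _ _ (P 1%N) (P 0%N)) => v def_v; exists v; apply: ((lker0_inj i).1 i0); rewrite e'E.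
rewrite dd; apply/vspaceP => x; rewrite !memv_ker.
by rewrite -[RHS](inj_eq ((lker0_inj i).1 i0)) linear0 e'E.
Qed.

End ProjectiveDimension.

(** * Indecomposable projective modules of a Nakayama algebra *)

Section SimpleCovers.
Variables (K : fieldType) (A : falgType K).
Implicit Types M N P S T : rmod A.

Definition simple_covers (I : finType) (S P : I -> rmod A)
    (p : forall i, rhom (P i) (S i)) : Prop :=
  [/\ forall i, simple_rmod (S i),
      forall i j, rmod_iso (S i) (S j) -> i = j,
      forall T, simple_rmod T -> exists i, rmod_iso T (S i)
    & forall i, projective_cover (p i)].

Lemma complement_retract M (U V : {vspace M}) N (i : rhom N M) :
  is_submod V -> (U + V)%VS = fullv -> (U :&: V)%VS = 0%VS ->
  lker i = 0%VS -> limg i = U -> exists w : rhom M N, forall x, w (i x) = x.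
Proof.
move=> sV UV UcV i0 iU; have [X [q [qf qV]]] := quo_exists sV.
have qi0 : lker (rcomp q i) = 0%VS.
  apply/eqP; rewrite -subv0; apply/subvP => x.
  rewrite memv_ker rcompE -memv_ker qV memv0 => ixV.
  have : i x \in (U :&: V)%VS by rewrite memv_cap ixV andbT -iU memv_img ?memvf.
  by rewrite UcV memv0 -(inj_eq ((lker0_inj i).1 i0)) linear0.
have qif : limg (rcomp q i) = fullv.
  apply/limg_fullP => y; have /limg_fullP/(_ y)[x ->] := qf.
  have : x \in (U + V)%VS by rewrite UV memvf.
  case/memv_addP => u; rewrite -iU => /limgP[n ->] [v vV ->]; exists n.
  rewrite rcompE linearD /=; move: vV; rewrite -qV memv_ker => /eqP->.
  by rewrite addr0.
have [g [gq _]] := rmod_iso_inv qi0 qif.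
by exists (rcomp g q) => x; rewrite rcompE -(rcompE q i) gq.
Qed.

(** Descent on dimension: if a projective decomposes, a map that is nonzero on it is nonzero on one
    of the two summands. *)
Lemma indec_cover_exists S : simple_rmod S ->
  exists P (f : rhom P S),
    [/\ projective_rmod P, indecomposable_rmod P & limg f <> 0%VS].
Proof.
move=> sS; have [P [f [pP ff]]] := enough_proj S.
have nzf : limg f <> 0%VS by rewrite ff; exact: sS.1.
move: pP nzf {ff}.
have [n] := ubnP (dim P); elim: n P f => // n IH P f ltn pP nzf.
have [iP|niP] := pselect (indecomposable_rmod P); first by exists P, f.
have nzP : rmod_nonzero P.
  move=> P0; apply: nzf; apply/limg0P => v.
  have -> : v = 0 by apply/eqP; rewrite -memv0 -P0 memvf.
  by rewrite linear0.
have [U [V [sU sV UV [UcV nzU nzV]]]] : exists U V : {vspace P},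
    [/\ is_submod U, is_submod V, (U + V)%VS = fullv &
     [/\ (U :&: V)%VS = 0%VS, U <> 0%VS & V <> 0%VS]].
  apply: contrapT => H; apply: niP; split=> // U V sU sV UV UcV.
  have [->|nzU] := pselect (U = 0%VS); first by left.
  have [->|nzV] := pselect (V = 0%VS); first by right.
  by case: H; exists U, V.
have step W W' : is_submod W -> is_submod W' -> (W + W')%VS = fullv ->
    (W :&: W')%VS = 0%VS -> W' <> 0%VS -> (f @: W)%VS <> 0%VS ->
    exists P' (f' : rhom P' S),
    [/\ projective_rmod P', indecomposable_rmod P' & limg f' <> 0%VS].
  move=> sW sW' WW' WcW' nzW' nzfW.
  have [N [i [i0 iW]]] := sub_exists sW.
  have [w wi] := complement_retract sW' WW' WcW' i0 iW.
  apply: (IH N (rcomp f i)); last by rewrite limg_rcomp iW.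
    rewrite ltnS in ltn; apply: leq_trans ltn; rewrite -!dimvf -WW' dimv_disjoint_sum //.
    rewrite -iW limg_dim_eq ?i0 ?capv0 //.
    by rewrite -[X in (X < _)%N]addn0 ltn_add2l lt0n dimv_eq0; apply/eqP.
  exact: proj_retract wi.
have [fU|nfU] := pselect ((f @: U)%VS = 0%VS); last exact: (step U V).
apply: (step V U) => //; [by rewrite addvC | by rewrite capvC |].
by move=> fV; apply: nzf; rewrite -UV limgD fU fV addv0.
Qed.

(** The [T i] are the composition factors of [M]: a map to a simple module is nonzero on the simple
    submodule [T0] or factors through the quotient by it. *)
Lemma simple_quotients_finite M : exists (I : finType) (T : I -> rmod A),
  (forall i, simple_rmod (T i)) /\
  forall S (f : rhom M S), simple_rmod S -> limg f <> 0%VS ->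
    exists i, rmod_iso S (T i).
Proof.
have [n] := ubnP (dim M); elim: n M => // n IH M ltn.
have [M0|nzM] := pselect ((fullv : {vspace M}) = 0%VS).
  exists void, (fun=> M); split=> [[]|S f _ nzf].
  case: nzf; apply/limg0P => v.
  have -> : v = 0 by apply/eqP; rewrite -memv0 -M0 memvf.
  by rewrite linear0.
have [T0 [i [sT0 i0 _]]] := simple_sub (@submodf _ _ M) nzM.
have [N [q [qf qi]]] := quo_exists (submod_limg i).
have [|I [T [sT TP]]] := IH N.
  rewrite ltnS in ltn; apply: leq_trans ltn.
  rewrite -!dimvf -qf -(limg_ker_dim q fullv) capfv qi -[X in (X < _)%N]add0n.
  rewrite ltn_add2r lt0n dimv_eq0; apply/eqP => i0'; apply: sT0.1.
  by rewrite -i0; apply/esym/lkerfP/limg0P.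
exists (option I), (fun o => if o is Some j then T j else T0).
split=> [[j|]|S f sS nzf] //.
have [fi0|nfi] := pselect (limg (rcomp f i) = 0%VS); last first.
  by exists None; apply/rmod_iso_sym/(schur sT0 sS nfi).
have [|h hq] := factor_epi (f := f) qf.
  by rewrite qi lkerE -limg_rcomp fi0.
have [|j Sj] := TP S h sS; last by exists (Some j).
by move/limg0P => h0; apply: nzf; apply/limg0P => v; rewrite -hq h0.
Qed.

Lemma total_proj_cover P S (f : rhom P S) :
  projective_rmod P -> simple_rmod S -> limg f <> 0%VS ->
  (forall U V : {vspace P}, is_submod U -> is_submod V ->
     (U <= V)%VS \/ (V <= U)%VS) ->
  projective_cover f.
Proof.
move=> pP sS nzf tot; split=> //.
  by split; [exact: rhomP | exact: simple_epi].
move=> U sU; have [le|le] := tot U (lker f) sU (submod_ker f).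
  by move/addv_idPr: le => -> /lkerfP f0; case: nzf; apply/limg0P.
by move/addv_idPl: le => ->.
Qed.

Lemma simple_covers_exist : nakayama A ->
  exists (I : finType) (S P : I -> rmod A) p, @simple_covers I S P p.
Proof.
move=> nak; have [I [T [sT TP]]] := simple_quotients_finite (regmod A).
(* [r] selects one index per isomorphism class; isomorphic [T i] and [T j] give the same predicate,
   hence the same pick. *)
pose r i := odflt i [pick j | `[< rmod_iso (T i) (T j) >]].
have rP i : rmod_iso (T i) (T (r i)).
  by rewrite /r; case: pickP => [j /asboolP|_] //=; exact: rmod_iso_refl.
have r_eq i j : rmod_iso (T i) (T j) -> r i = r j.
  move=> ij; rewrite /r (@eq_pick _ _ (fun k => `[< rmod_iso (T j) (T k) >])).
    case: pickP => //= /(_ j) /asboolP[]; exact: rmod_iso_refl.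
  move=> k; apply/asboolP/asboolP => H; last exact: rmod_iso_trans H.
  exact: rmod_iso_trans (rmod_iso_sym ij) H.
pose J := {i | r i == i}; pose S (j : J) := T (val j).
have sS j : simple_rmod (S j) by exact: sT.
have exP j : exists P (f : rhom P (S j)), projective_cover f.
  have [P [f [pP iP nzf]]] := indec_cover_exists (sS j).
  have [c [R MR]] := uniserial_radical_series (nak _ iP).
  by exists P, f; apply: total_proj_cover => //; exact: rs_total MR.
pose P j := sval (cid (exP j)); pose p j := sval (cid (svalP (cid (exP j)))).
exists J, S, P, p; split=> // [i j /r_eq eq_r|U sU|j].
- by apply: val_inj; rewrite /= -(eqP (valP i)) -(eqP (valP j)).
- have [u u0] : exists u : U, u <> 0.
    apply: contrapT => /forallNP H; apply: sU.1; apply/eqP; rewrite -subv0.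
    by apply/subvP => v _; rewrite memv0; have /contrapT-> := H v.
  have [h hE] := regmod_hom u.
  have nzh : limg h <> 0%VS by move/limg0P/(_ (1 : A)); rewrite hE ract_id.
  have [i Ui] := TP U h sU nzh.
  have rr : r (r i) == r i by apply/eqP/esym/r_eq.
  by exists (exist _ (r i) rr); apply: rmod_iso_trans Ui (rP i).
exact: svalP (cid (svalP (cid (exP j)))).
Qed.

End SimpleCovers.

(** * Radical layers of the indecomposable projectives *)

Section RadicalLayers.
Variables (K : fieldType) (A : falgType K) (I : finType) (S P : I -> rmod A).
Variable p : forall i, rhom (P i) (S i).
Hypothesis SP : simple_covers p.
Implicit Types M N T : rmod A.

Lemma sc_simple i : simple_rmod (S i). Proof. by case: SP. Qed.
Lemma sc_inj i j : rmod_iso (S i) (S j) -> i = j.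
Proof. by case: SP => _ + _ _; apply. Qed.
Lemma sc_all T : simple_rmod T -> exists i, rmod_iso T (S i).
Proof. by case: SP => _ _ + _; apply. Qed.
Lemma sc_cover i : projective_cover (p i). Proof. by case: SP. Qed.
Lemma sc_proj i : projective_rmod (P i). Proof. by case: (sc_cover i). Qed.
Arguments sc_proj : clear implicits.
Lemma sc_epi i : limg (p i) = fullv. Proof. by case: (sc_cover i) => _ []. Qed.

Lemma hom_to_simple M i (f : rhom M (S i)) : limg f <> 0%VS ->
  exists g : rhom (P i) M, limg (rcomp f g) <> 0%VS.
Proof.
move=> nzf; have [|g gE] := proj_lift (g := f) (f := p i) (sc_proj i).
  by rewrite (simple_epi (sc_simple i) nzf) subvf.
exists g => /limg0P fg; apply: (sc_simple i).1; rewrite -(sc_epi i).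
by apply/limg0P => v; rewrite -gE -rcompE fg.
Qed.

Lemma hom_from_quotient M N (q : rhom M N) i (f : rhom (P i) N) :
  limg q = fullv -> limg f <> 0%VS -> exists g : rhom (P i) M, limg g <> 0%VS.
Proof.
move=> qf nzf; have [|g gE] := proj_lift (g := q) (f := f) (sc_proj i).
  by rewrite qf subvf.
exists g => /limg0P g0; apply: nzf; apply/limg0P => v.
by rewrite -gE g0 linear0.
Qed.

Lemma hom_from_cover i T : simple_rmod T -> rmod_iso T (S i) ->
  exists f : rhom (P i) T, limg f = fullv.
Proof.
move=> sT /rmod_isoP[e [e0 ee]]; have [e' [_ ee']] := rmod_iso_inv e0 ee.
have [|f fE] := proj_lift (g := e) (f := p i) (sc_proj i); first by rewrite ee subvf.
exists f; apply: simple_epi => // /limg0P f0; apply: (sc_simple i).1.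
by rewrite -(sc_epi i); apply/limg0P => v; rewrite -fE f0 linear0.
Qed.

Lemma nonzero_hom M : rmod_nonzero M -> exists i (f : rhom (P i) M), limg f <> 0%VS.
Proof.
move=> nzM; have [T [q [sT qf _]]] := simple_quo (@submod0 _ _ M) (nesym nzM).
have [i Ti] := sc_all sT; have [f ff] := hom_from_cover sT Ti.
have [|g gE] := hom_from_quotient qf (f := f); first by rewrite ff; exact: sT.1.
by exists i, g.
Qed.

(* A nonzero map P i -> M means that S i is a composition factor of M. *)
Lemma pd_simples m M :
  (forall i (f : rhom (P i) M), limg f <> 0%VS -> pd m (S i)) -> pd m M.
Proof.
have [n] := ubnP (dim M); elim: n M => // n IH M ltn pdS.
have [M0|nzM] := pselect ((fullv : {vspace M}) = 0%VS).
  by apply: (@pd_leq _ _ 0 m) => //; exact: zero_proj.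
have [T [i [sT i0 _]]] := simple_sub (@submodf _ _ M) nzM.
have [N [q [qf qi]]] := quo_exists (submod_limg i).
apply: (pd_horseshoe i0 (esym qi) qf).
  have [j Tj] := sc_all sT; have [f ff] := hom_from_cover sT Tj.
  apply: (pd_iso (rmod_iso_sym Tj)); apply: (pdS _ (rcomp i f)).
  rewrite limg_rcomp ff => /limg0P iz; apply: sT.1; rewrite -i0.
  by apply/esym/lkerfP.
apply: IH => [|j f /(hom_from_quotient qf)[g]]; last exact: pdS.
rewrite ltnS in ltn; apply: leq_trans ltn.
rewrite -!dimvf -qf -(limg_ker_dim q fullv) capfv qi -[X in (X < _)%N]add0n.
rewrite ltn_add2r lt0n dimv_eq0; apply/eqP => i0'; apply: sT.1.
by rewrite -i0; apply/esym/lkerfP/limg0P.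
Qed.

Section Layer.
Variables (M : rmod A) (c : nat) (R : nat -> {vspace M}).
Hypothesis MR : radical_series c R.

(** A simple quotient of [R k] is covered by some [P j]; the lifted map has image in [R k] but not
    in [R k.+1], hence equal to [R k]. *)
Lemma layer_exists k : (k < c)%N -> exists i (f : rhom (P i) M), limg f = R k.
Proof.
move=> ltk; have [N [i [i0 iR]]] := sub_exists (rs_submod MR k).
pose W := (i @^-1: R k.+1)%VS.
have iW : (i @: W)%VS = R k.+1.
  apply/vspaceP => x; apply/memv_imgP/idP => [[v]|xR].
    by rewrite preimE => ? ->.
  have : x \in limg i by rewrite iR (subvP (rs_mono MR (leqnSn k))).
  by case/limgP => v def_x; exists v; rewrite ?preimE -?def_x.
have pW : W <> fullv.
  by move=> Wf; have := rs_lt MR (ltnSn k) ltk; rewrite -iW Wf iR subvv.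
have sW : is_submod W by exact/submod_preim/(rs_submod MR).
have [T [q [sT qf Wq]]] := simple_quo sW pW.
have [j Tj] := sc_all sT; have [f ff] := hom_from_cover sT Tj.
have [|g gE] := proj_lift (g := q) (f := f) (sc_proj j); first by rewrite qf subvf.
have le : (limg (rcomp i g) <= R k)%VS by rewrite limg_rcomp -iR limgS ?subvf.
exists j, (rcomp i g); apply: contrapT => neR; apply: sT.1.
have := rs_next MR (submod_limg _) le neR; rewrite -iW limg_rcomp limg_ker0 ?i0 // => leW.
rewrite -ff; apply/limg0P => v; rewrite -gE; apply/eqP; rewrite -memv_ker.
by apply/(subvP Wq)/(subvP leW); rewrite memv_img ?memvf.
Qed.

Lemma layer_unique k i j (f : rhom (P i) M) (g : rhom (P j) M) :
  (k < c)%N -> limg f = R k -> limg g = R k -> i = j.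
Proof.
move=> ltk fR gR; have [N [e [e0 eR]]] := sub_exists (rs_submod MR k).
have lift l (h : rhom (P l) M) : limg h = R k ->
    exists h' : rhom (P l) N, limg h' = fullv.
  move=> hR; have [|h' hE] := factor_mono e0 (f := h); first by rewrite hR eR.
  exists h'; apply/eqP; rewrite -(eq_limg_ker0 _ _ (introT eqP e0)).
  by rewrite -limg_rcomp eR -hR; apply/eqP; apply: eq_in_limg => v _; rewrite rcompE.
have nzN : rmod_nonzero N.
  move=> N0; move: ltk; rewrite ltnNge -(rs_eq0 MR) -eR N0 limg0 eqxx //.
have [T [q [sT qf _]]] := simple_quo (@submod0 _ _ N) (nesym nzN).
have top l (h : rhom (P l) M) : limg h = R k -> rmod_iso (S l) T.
  move=> /lift[h' h'f]; apply: (cover_top (f := rcomp q h') (sc_simple l) (sc_cover l)) => //.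
  by rewrite limg_rcomp h'f qf; exact: sT.1.
by apply: sc_inj; apply: rmod_iso_trans (top _ _ fR) (rmod_iso_sym (top _ _ gR)).
Qed.

End Layer.

Lemma sc_uniserial : nakayama A ->
  forall i, exists c R, @radical_series _ _ (P i) c R.
Proof.
move=> nak i; apply: uniserial_radical_series; apply: nak.
exact: cover_indec (sc_simple i) (sc_cover i).
Qed.

Variables (c : I -> nat) (R : forall i, nat -> {vspace (P i)}).
Hypothesis cR : forall i, radical_series (c i) (R i).

Lemma len_gt0 i : (0 < c i)%N.
Proof.
rewrite ltnNge -(rs_eq0 (cR i)) (rs0 (cR i)); apply/eqP => Pi0.
apply: (cover_ker_proper (sc_simple i) (sc_cover i)); apply/eqP.
by rewrite eqEsubv subvf Pi0 sub0v.
Qed.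

Lemma ker_top i : lker (p i) = R i 1.
Proof.
have Ri := cR i; apply: subv_anti; apply/andP; split.
  apply: (rs_next Ri); [exact: submod_ker | by rewrite (rs0 Ri) subvf |].
  by rewrite (rs0 Ri); exact: (cover_ker_proper (sc_simple i) (sc_cover i)).
apply: (cover_radical (sc_simple i) (sc_cover i)); first exact: rs_submod.
by rewrite -(rs0 Ri) => /(rs_eq Ri (len_gt0 i) (leq0n _)).
Qed.

Lemma radical_layer_inj_aux x y z (f : rhom (P z) (P x)) (g : rhom (P z) (P y)) :
  nakayama A -> limg f = R x 1 -> limg g = R y 1 -> (1 < c x)%N ->
  (lker g <= lker f)%VS -> x = y.
Proof.
move=> nak fR gR cx /subvP gf.
have [u0 fu0] : exists u, f u <> 0.
  apply: contrapT => /forallNP H; move: cx; rewrite ltnNge -(rs_eq0 (cR x)) -fR.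
  by move/eqP; apply; apply/limg0P => u; have /contrapT := H u.
have [D [i [j [a [b [ai bj bi aj dec]]]]]] := dsum_exists (P x) (P y).
pose G := limg (radd (rcomp i f) (rcomp j g)).
pose m0 := i (f u0).
(* A submodule maximal among those containing [G] and avoiding [m0] makes [q m0] lie in every
   nonzero submodule of the quotient, which is therefore indecomposable. *)
pose Q (W : {vspace D}) := [/\ is_submod W, (G <= W)%VS & m0 \notin W].
have QG : Q G.
  split=> //; first exact: submod_limg.
  (* If [m0] were in [G], some [u] would satisfy [g u = 0] and [f u = f u0]; then [lker g <= lker f]
     would give [f u0 = 0]. *)
  apply/negP => /limgP[u]; rewrite !rE => m0E.
  have : g u = 0 by rewrite -(bj (g u)) -[RHS](bi (f u0)) -/m0 m0E linearD /= bi add0r.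
  move/eqP; rewrite -memv_ker => /gf; rewrite memv_ker => /eqP fu; apply: fu0.
  by rewrite -(ai (f u0)) -/m0 m0E linearD /= ai aj fu addr0.
have [W [[sW GW m0W] _ max]] := max_vspace QG.
have [M [q [qf qW]]] := quo_exists sW.
have nzq : q m0 != 0 by rewrite -memv_ker qW.
have mem U : is_submod U -> U <> 0%VS -> q m0 \in U.
  move=> sU nzU; apply: contrapT => /negP qU; apply: nzU.
  have /max eqW : Q (q @^-1: U)%VS.
    split; [exact: submod_preim | | by rewrite preimE].
    apply/(subv_trans GW)/subvP => v.
    by rewrite -qW memv_ker preimE => /eqP->; rewrite mem0v.
  apply/eqP; rewrite -subv0; apply/subvP => w wU.
  have /limg_fullP/(_ w)[v def_w] := qf.
  rewrite memv0 def_w -memv_ker qW -eqW ?preimE -?def_w //.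
  apply/subvP => t; rewrite -qW memv_ker preimE => /eqP->; exact: mem0v.
have iM : indecomposable_rmod M.
  split=> [M0|U V sU sV _ UcV].
    by case/eqP: nzq; apply/eqP; rewrite -memv0 -M0 memvf.
  have [->|nzU] := pselect (U = 0%VS); first by left.
  have [->|nzV] := pselect (V = 0%VS); first by right.
  case/eqP: nzq; apply/eqP; rewrite -memv0 -UcV memv_cap.
  by rewrite !mem.
have [d [E ME]] := uniserial_radical_series (nak _ iM).
have [s sd xE] := rs_ex ME (submod_limg (rcomp q i)).
have [t td yE] := rs_ex ME (submod_limg (rcomp q j)).
have qfg u : q (i (f u)) = - q (j (g u)).
  apply/eqP; rewrite -subr_eq0 opprK -linearD -memv_ker qW (subvP GW) //.
  by apply/limgP; exists u; rewrite !rE.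
(* In [M] the radicals of the images of [P x] and [P y] are both the image of [P z], up to sign.
   They contain [q m0], so they are nonzero and their depths agree. *)
have eqE : E (s + 1)%N = E (t + 1)%N.
  rewrite -(rs_img (cR x) ME xE) -(rs_img (cR y) ME yE) -fR -gR.
  apply/vspaceP => w; apply/memv_imgP/memv_imgP => [[_ /limgP[u ->] ->]|[_ /limgP[u ->] ->]].
    exists (g (- u)); first by rewrite memv_img ?memvf.
    by rewrite !rcompE qfg !linearN.
  exists (f (- u)); first by rewrite memv_img ?memvf.
  by rewrite !rcompE !linearN /= qfg opprK.
have m0E : q m0 \in E (s + 1)%N.
  rewrite -(rs_img (cR x) ME xE) -fR; apply/memv_imgP; exists (f u0).
    by rewrite memv_img ?memvf.
  by rewrite rcompE.
have ltE k : q m0 \in E k -> (k < d)%N.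
  move=> m0k; rewrite ltnNge; apply/negP => /(rs_ge ME) Ek.
  by move: m0k nzq; rewrite Ek memv0 => ->.
have /addIn st : (s + 1 = t + 1)%N.
  by apply: (rs_eq ME _ _ eqE); apply/ltnW/ltE => //; rewrite -eqE.
(* The images of [P x] and [P y] are both [E s] and together span [M]; so both map onto [M], which
   has a single top. *)
have fullE : E s = fullv.
  apply/subfvP/subvP => w _; have /limg_fullP/(_ w)[v ->] := qf.
  rewrite [v]dec linearD memvD //=.
    by rewrite -(rcompE q i) -xE memv_img ?memvf.
  by rewrite st -(rcompE q j) -yE memv_img ?memvf.
have s0 : s = 0%N by apply: (rs_eq ME) => //; rewrite fullE (rs0 ME).
have lt0 : (0 < d)%N by apply: (leq_trans _ (ltE _ m0E)); rewrite addn1.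
apply: (layer_unique ME lt0); first by rewrite -s0; exact: xE.
by rewrite -s0 st; exact: yE.
Qed.

(* The pushout of P_x and P_y along P_z has a subdirectly irreducible, hence *)
(* indecomposable, quotient with tops S_x and S_y, which must be uniserial.  *)
Lemma radical_layer_inj x y z (f : rhom (P z) (P x)) (g : rhom (P z) (P y)) :
  nakayama A -> limg f = R x 1 -> limg g = R y 1 ->
  (1 < c x)%N -> (1 < c y)%N -> x = y.
Proof.
move=> nak fR gR cx cy.
have [le|le] := rs_total (cR z) (submod_ker f) (submod_ker g).
  exact: esym (radical_layer_inj_aux nak gR fR cy le).
exact: radical_layer_inj_aux nak fR gR cx le.
Qed.

End RadicalLayers.

Arguments sc_proj {K A I S P p} SP i.

(** * Blocks *)

Section CentralSplit.
Variables (K : fieldType) (A : falgType K).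

Lemma ideal_unit (T T' : {vspace A}) (e e' : A) :
  (forall a b, b \in T -> a * b \in T /\ b * a \in T) ->
  (forall a b, b \in T' -> a * b \in T' /\ b * a \in T') ->
  (T :&: T' = 0)%VS -> e \in T -> e' \in T' -> 1 = e + e' ->
  forall a, a \in T -> e * a = a /\ a * e = a.
Proof.
move=> idT idT' TT' eT eT' one a aT.
have zero b : b \in T -> b \in T' -> b = 0.
  by move=> bT bT'; apply/eqP; rewrite -memv0 -TT' memv_cap bT.
split.
  rewrite -[RHS]mul1r one mulrDl (zero (e' * a)) ?addr0 //.
    by case: (idT e' a aT).
  by case: (idT' a e' eT').
rewrite -[RHS]mulr1 one mulrDr (zero (a * e')) ?addr0 //.
  by case: (idT e' a aT).
by case: (idT' a e' eT').
Qed.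

Lemma ideal_aspace (T : {vspace A}) (e : A) :
  T <> 0%VS -> (forall a b, b \in T -> a * b \in T /\ b * a \in T) ->
  e \in T -> (forall a, a \in T -> e * a = a /\ a * e = a) -> is_aspace T.
Proof.
move=> nzT idT eT unit; apply/andP; split.
  apply/has_algidP; exists e; split=> //.
  apply/eqP => e0; apply: nzT; apply/eqP; rewrite -subv0.
  by apply/subvP => a /unit[<- _]; rewrite e0 mul0r mem0v.
by apply/prodvP => a b aT bT; case: (idT b a aT).
Qed.

(** The components [e], [e'] of 1 are identities of the two ideals, and multiplication by them is an
    algebra isomorphism of [A] with the product. *)
Lemma connected_ideals (T T' : {vspace A}) : connected_alg A ->
  (forall a b, b \in T -> a * b \in T /\ b * a \in T) ->
  (forall a b, b \in T' -> a * b \in T' /\ b * a \in T') ->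
  (T + T' = fullv)%VS -> (T :&: T' = 0)%VS -> T <> 0%VS -> T' <> 0%VS -> False.
Proof.
move=> conn idT idT' TT' TcT' nzT nzT'.
have : (1 : A) \in (T + T')%VS by rewrite TT' memvf.
case/memv_addP => e eT [e' e'T one].
have unit := ideal_unit idT idT' TcT' eT e'T one.
have unit' : forall a, a \in T' -> e' * a = a /\ a * e' = a.
  by apply: (ideal_unit idT' idT _ e'T eT); rewrite 1?capvC // addrC.
pose TA := ASpace (ideal_aspace nzT idT eT unit).
pose TA' := ASpace (ideal_aspace nzT' idT' e'T unit').
pose B : falgType K := subvs_of TA; pose C : falgType K := subvs_of TA'.
have algE : algid TA = e.
  by rewrite -(algidr (A := TA) eT); case: (unit _ (memv_algid TA)) => ->.
have algE' : algid TA' = e'.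
  by rewrite -(algidr (A := TA') e'T); case: (unit' _ (memv_algid TA')) => ->.
have eaT a : e * a \in T by case: (idT a e eT).
have e'aT a : e' * a \in T' by case: (idT' a e' e'T).
have eae a b : e * a * (e * b) = e * (a * b).
  by rewrite mulrA (unit _ (eaT a)).2 -mulrA.
have e'ae a b : e' * a * (e' * b) = e' * (a * b).
  by rewrite mulrA (unit' _ (e'aT a)).2 -mulrA.
pose phi (a : A) : (B * C)%type := (vsproj TA (e * a), vsproj TA' (e' * a)).
have phi1 a : vsval (phi a).1 = e * a by rewrite vsprojK.
have phi2 a : vsval (phi a).2 = e' * a by rewrite vsprojK.
have phi_lin : linear phi.
  by move=> k a b; congr pair; apply: val_inj; rewrite /= !vsprojK // mulrDr scalerAr.
have phi_mon : monoid_morphism phi.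
  split; first by congr pair; apply: val_inj; rewrite /= ?algE ?algE' vsprojK // mulr1.
  by move=> a b; congr pair; apply: val_inj; rewrite /= !vsprojK ?eae ?e'ae.
pose fl := GRing.isLinear.Build K A (B * C)%type *:%R phi phi_lin.
pose fm := GRing.isMonoidMorphism.Build A (B * C)%type phi phi_mon.
pose f : {lrmorphism A -> (B * C)%type} := HB.pack phi fl fm.
apply: (conn B C f); exists (fun xy => vsval xy.1 + vsval xy.2).
  by move=> a; rewrite phi1 phi2 -mulrDl -one mul1r.
have zero b : b \in T -> b \in T' -> b = 0.
  by move=> bT bT'; apply/eqP; rewrite -memv0 -TcT' memv_cap bT.
case=> x y; congr pair; apply: val_inj; rewrite /= vsprojK // mulrDr.
  rewrite (unit _ (subvsP x)).1 (zero (e * _)) ?addr0 //.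
  by case: (idT' e _ (subvsP y)).
rewrite (unit' _ (subvsP y)).1 (zero (e' * _)) ?add0r //.
by case: (idT e' _ (subvsP x)).
Qed.

End CentralSplit.

Section Blocks.
Variables (K : fieldType) (A : falgType K) (I : finType) (S P : I -> rmod A).
Variable p : forall i, rhom (P i) (S i).
Hypothesis SP : simple_covers p.
Implicit Types M N T : rmod A.

(** All composition factors of [U] have index in [J]; a nonzero map from [P i] detects the factor
    [S i]. *)
Definition in_block (J : pred I) M (U : {vspace M}) : Prop :=
  forall i (f : rhom (P i) M), (limg f <= U)%VS -> limg f <> 0%VS -> J i.

Lemma in_block_img (J : pred I) M N (g : rhom M N) (U : {vspace M}) :
  is_submod U -> in_block J U -> in_block J (g @: U)%VS.
Proof.
move=> sU JU i f fU nzf; have [X [e [e0 eU]]] := sub_exists sU.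
have [|h hE] := proj_lift (g := rcomp g e) (f := f) (sc_proj SP i).
  by rewrite limg_rcomp eU.
apply: (JU i (rcomp e h)) => [|/limg0P eh].
  by rewrite limg_rcomp -eU limgS ?subvf.
by apply: nzf; apply/limg0P => v; rewrite -hE rcompE -(rcompE e h) eh linear0.
Qed.

Lemma in_blockD (J : pred I) M (U V : {vspace M}) :
  is_submod U -> is_submod V -> in_block J U -> in_block J V -> in_block J (U + V)%VS.
Proof.
move=> sU sV JU JV i f fUV nzf; have [N [q [qf qU]]] := quo_exists sU.
have [qf0|nzqf] := pselect (limg (rcomp q f) = 0%VS).
  apply: (JU i f) => //; rewrite -qU; apply/limg_subP => v.
  by rewrite memv_ker -(rcompE q f); apply/eqP; exact: (limg0P (rcomp q f)).1 qf0 v.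
apply: (in_block_img (g := q) sV JV) nzqf.
rewrite limg_rcomp; apply: subv_trans (limgS q fUV) _.
by rewrite limgD -qU (eqP (_ : q @: lker q == 0)%VS) -?lkerE ?add0v.
Qed.

Lemma block_exists (J : pred I) M : exists T : {vspace M},
  [/\ is_submod T, in_block J T &
      forall U, is_submod U -> in_block J U -> (U <= T)%VS].
Proof.
pose Q (U : {vspace M}) := is_submod U /\ in_block J U.
have Q0 : Q 0%VS.
  split; [exact: submod0 | by move=> i f; rewrite subv0 => /eqP].
have [T [[sT JT] _ max]] := max_vspace Q0; exists T; split=> // U sU JU.
have <- : (T + U)%VS = T; last exact: addvSr.
by apply: max; [split; [exact: submodD | exact: in_blockD] | exact: addvSl].
Qed.

Lemma hom_to_regmod i : exists f : rhom (P i) (regmod A), limg f <> 0%VS.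
Proof.
have [u nzu] : exists u : S i, u <> 0.
  apply: contrapT => /forallNP H; apply: (sc_simple SP i).1; apply/eqP.
  by rewrite -subv0; apply/subvP => v _; rewrite memv0; have /contrapT-> := H v.
have [h hE] := regmod_hom u.
have nzh : limg h <> 0%VS by move/limg0P/(_ (1 : A)); rewrite hE ract_id.
have [g nzg] := hom_to_simple SP nzh; exists g => /limg0P g0.
by apply: nzg; apply/limg0P => v; rewrite rcompE g0 linear0.
Qed.

(** Let [T] and [T'] be the largest right ideals with all factors in [J], respectively outside. Left
    multiplications are endomorphisms of the regular module and preserve factors, so both are
    two-sided. They meet in 0 for lack of a common factor, and span [A] because the image of each
    [P k] in [A] lies in one of them. *)
Lemma connected_block (J : pred I) : connected_alg A ->
  (forall i j (f : rhom (P i) (P j)), limg f <> 0%VS -> J i = J j) ->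
  forall i j, J i -> J j.
Proof.
move=> conn closed i j Ji; apply: contrapT => /negP nJj.
pose J' := predC J.
have [T [sT JT Tmax]] := block_exists J (regmod A).
have [T' [sT' JT' Tmax']] := block_exists J' (regmod A).
have limgT k (f : rhom (P k) (regmod A)) : (limg f <= if J k then T else T')%VS.
  case Jk: (J k); [apply: Tmax | apply: Tmax']; try exact: submod_limg.
    apply: in_block_img; first exact: submodf.
    by move=> l g _ /closed->.
  apply: in_block_img; first exact: submodf.
  by move=> l g _ /closed; rewrite /= Jk => ->.
have ideal (J0 : pred I) (U : {vspace regmod A}) : is_submod U -> in_block J0 U ->
    (forall V, is_submod V -> in_block J0 V -> (V <= U)%VS) ->
    forall a b : A, b \in U -> a * b \in U /\ b * a \in U.
  move=> sU JU Umax a b bU; split.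
    have [h hE] := regmod_hom (a : regmod A).
    have : (h @: U <= U)%VS by apply: Umax; [exact: submod_img | exact: in_block_img].
    by move/subvP; apply; rewrite -regmodE -hE memv_img.
  by rewrite -regmodE; apply: (submodP _).1.
apply: (connected_ideals (T := T) (T' := T') conn).
- exact: ideal JT Tmax.
- exact: ideal JT' Tmax'.
- apply: contrapT => nf; have [X [q [sX qf Tq]]] := simple_quo (submodD sT sT') nf.
  have [k Xk] := sc_all SP sX; have [f ff] := hom_from_cover SP sX Xk.
  have [|g gE] := proj_lift (g := q) (f := f) (sc_proj SP k); first by rewrite qf subvf.
  apply: sX.1; rewrite -ff; apply/limg0P => v; rewrite -gE; apply/eqP.
  rewrite -memv_ker (subvP Tq) //.
  have gv : g v \in limg g by rewrite memv_img ?memvf.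
  have := subvP (limgT k g) _ gv; case: ifP => _; apply: subvP.
    exact: addvSl.
  exact: addvSr.
- apply: contrapT => nz; have [N [e [e0 eT]]] := sub_exists (submodI sT sT').
  have [|k [f nzf]] := nonzero_hom SP (M := N).
    by move=> N0; apply: nz; rewrite -eT N0 limg0.
  have le : (limg (rcomp e f) <= T :&: T')%VS by rewrite limg_rcomp -eT limgS ?subvf.
  have nzef : limg (rcomp e f) <> 0%VS.
    move/limg0P => ef; apply: nzf; apply/limg0P => v; apply: ((lker0_inj e).1 e0).
    by rewrite -rcompE ef linear0.
  move: le; rewrite subv_cap => /andP[/JT/(_ nzef) Jk /JT'/(_ nzef)].
  by rewrite /= Jk.
- have [f nzf] := hom_to_regmod i; have := limgT i f.
  by rewrite Ji => le T0; apply: nzf; apply/eqP; rewrite -subv0 -T0.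
have [f nzf] := hom_to_regmod j; have := limgT j f.
by rewrite (negbTE nJj) => le T0; apply: nzf; apply/eqP; rewrite -subv0 -T0.
Qed.

End Blocks.

(** * The Kupisch cycle *)

Section Cycle.
Variables (I : finType) (D : pred I) (s : I -> I).
Hypothesis s_inj : {in D &, injective s}.
Hypothesis closed : forall J : pred I, (forall i, D i -> J i = J (s i)) ->
  forall i j, J i -> J j.

(* A partial injection whose graph is connected is a path or a cycle; a path *)
(* is closed up by sending its end to its origin.                            *)
Lemma cyclic_extension : exists s' : I -> I,
  [/\ injective s', forall i, D i -> s' i = s i & forall i j, fconnect s' i j].
Proof.
have [allD|/existsNP[z /negP nDz]] := pselect (forall i, D i).
  have s_inj' : injective s by move=> i j; apply: s_inj; exact: allD.
  exists s; split=> // i j; apply: (closed (J := fconnect s i)) (connect0 _ i) => k _.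
  by rewrite same_fconnect1_r.
(* Endpoints become fixed points of [t]. The set of points leading to the endpoint [z] is invariant,
   hence everything, so [z] is the only endpoint. *)
pose t i := if D i then s i else i.
have toz j : fconnect t j z.
  apply: (closed (J := fun j => fconnect t j z)) (connect0 _ z) => i Di.
  have tE : t i = s i by rewrite /t Di.
  apply/idP/idP => [/connectP[[|k q] /=]|].
  - by move=> _ zi; move: nDz; rewrite zi Di.
  - case/andP=> /eqP tik kq zE; rewrite -tE.
    by apply/connectP; exists q; rewrite tik.
  by rewrite -tE; apply: connect_trans; exact: fconnect1.
have onlyz i : i != z -> D i.
  move=> niz; apply: contraT => nDi.
  suff tk m : iter m t i = i by move: niz; rewrite -(iter_findex (toz i)) tk eqxx.
  by elim: m => //= m ->; rewrite /t (negbTE nDi).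
(* The origin of the path: [s] takes at most [#|D|] values on [D], fewer than the size of [I] since
   [z] is outside [D]. *)
have [w wP] : exists w, forall i, D i -> s i != w.
  apply: contrapT => /forallNP H.
  have onto w : exists2 i, D i & s i = w.
    apply: contrapT => H'; apply: (H w) => i Di; apply/eqP => siw.
    by apply: H'; exists i.
  have : (#|[set: I]| <= #|s @: [set i | D i]|)%N.
    apply/subset_leq_card/subsetP => j _.
    have [i Di <-] := onto j; apply: imset_f; rewrite inE //.
  rewrite leqNgt => /negP; apply; apply: (leq_ltn_trans (leq_imset_card _ _)).
  apply: proper_card; rewrite properE subsetT /=.
  by apply/subsetPn; exists z; rewrite !inE.
pose s' i := if i == z then w else s i.
have s'_inj : injective s'.
  move=> i j; rewrite /s'; case: eqVneq => [->|iz]; case: eqVneq => [-> //|jz].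
  - by move=> e; move: (wP j (onlyz _ jz)); rewrite -e eqxx.
  - by move=> e; move: (wP i (onlyz _ iz)); rewrite e eqxx.
  by apply: s_inj; exact: onlyz.
have s'D i : D i -> s' i = s i.
  by rewrite /s'; case: eqVneq => // -> Dz; rewrite Dz in nDz.
have toz' j : fconnect s' j z.
  apply: (closed (J := fun j => fconnect s' j z)) (connect0 _ z) => i Di.
  by rewrite -s'D // (same_fconnect1 s'_inj).
exists s'; split=> // i j; apply: connect_trans (toz' i) _.
by rewrite fconnect_sym.
Qed.

End Cycle.

Section Kupisch.
Variables (K : fieldType) (A : falgType K) (I : finType) (S P : I -> rmod A).
Variable p : forall i, rhom (P i) (S i).
Hypothesis SP : simple_covers p.
Variables (c : I -> nat) (R : forall i, nat -> {vspace (P i)}).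
Hypothesis cR : forall i, radical_series (c i) (R i).

(** Compose the maps onto successive radicals; the bound in [rs_ker] shows that the next projective
    still has a nonzero radical. *)
Lemma layers_iter (s : I -> I) :
  (forall i, (1 < c i)%N -> exists f : rhom (P (s i)) (P i), limg f = R i 1) ->
  forall i k, (k < c i)%N ->
    exists f : rhom (P (iter k s i)) (P i), limg f = R i k.
Proof.
move=> s1 i; elim=> [|k IH] ltk.
  exists (rid (P i)); rewrite (rs0 (cR i)).
  by apply/limg_fullP => x; exists x; rewrite ridE.
have [f fR] := IH (ltnW ltk).
have [_ le] := rs_ker (cR _) (cR i) fR (ltnW (ltnW ltk)).
have [|g gR] := s1 (iter k s i).
  by rewrite -(ltn_add2l k) addn1 (leq_trans ltk).
by exists (rcomp f g); rewrite limg_rcomp gR (rs_img (cR _) (cR i) fR) addn1.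
Qed.

(** [s] sends [i] to the top of the radical of [P i]. It is injective where that radical is nonzero
    ([radical_layer_inj]) and its graph is connected ([connected_block]); [cyclic_extension] fills
    in the value at a simple projective. *)
Lemma kupisch : nakayama A -> connected_alg A ->
  exists s : I -> I, [/\ injective s, forall i j, fconnect s i j &
    forall i k, (k < c i)%N ->
      exists f : rhom (P (iter k s i)) (P i), limg f = R i k].
Proof.
move=> nak conn.
have ex i : exists j, (1 < c i)%N -> exists f : rhom (P j) (P i), limg f = R i 1.
  have [lt|le] := ltnP 1 (c i); last by exists i.
  by have [j [f fR]] := layer_exists SP (cR i) lt; exists j => _; exists f.
have [s sP] := choice ex.
have lay := layers_iter sP.
have [s' [s'_inj s'E s'c]] : exists s' : I -> I, [/\ injective s',
    forall i, (1 < c i)%N -> s' i = s i & forall i j, fconnect s' i j].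
  apply: cyclic_extension => [i j ci cj eqs|J Js].
    have [[f fR] [g gR]] := (sP i ci, sP j cj).
    by rewrite -eqs in g gR; exact: (radical_layer_inj SP cR nak fR gR).
  apply: (connected_block SP conn) => i j f nzf.
  have [k _ fR] := rs_ex (cR j) (submod_limg f).
  have ltk : (k < c j)%N.
    by rewrite ltnNge -(rs_eq0 (cR j)) -fR; apply/eqP.
  have [g gR] := lay j k ltk.
  have -> : i = iter k s j by exact: layer_unique SP _ _ _ (cR j) _ _ _ f g ltk fR gR.
  (* A nonzero map from [P i] to [P j] makes [i] an iterate of [j], and each intermediate vertex has
     a nonzero radical, so [J] is constant along the way. *)
  elim: k ltk {fR g gR} => //= k IH ltk.
  have [g gR] := lay j k (ltnW ltk).
  have [_ le] := rs_ker (cR _) (cR j) gR (ltnW (ltnW ltk)).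
  rewrite -Js ?IH ?(ltnW ltk) //.
  by rewrite -(ltn_add2l k) addn1 (leq_trans ltk).
exists s'; split=> //; apply: layers_iter => i ci.
by rewrite s'E //; exact: sP.
Qed.

End Kupisch.

(** * Syzygies of interval modules *)

Section IntervalCombinatorics.
Local Open Scope nat_scope.
Variables (n : nat) (f : nat -> nat).
Hypotheses (n_gt0 : 0 < n) (f_gt : forall a, a < f a).
Hypotheses (f_step : forall a, f a <= f a.+1) (f_per : forall a, f (a + n) = f a + n).

(* The interval module [a, b) has syzygy [b, f a); this says that its         *)
(* projective dimension is at most k.                                         *)
Fixpoint interval_pd k a b : bool :=
  (b == f a) || (if k is k'.+1 then interval_pd k' b (f a) else false).

(* x carries a heredity idempotent: the trace of P_x in every P_y is 0 or P_x. *)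
Definition heredity x : Prop :=
  f x <= x + n /\
  forall y, x < y < x + n -> f y <= x + n \/ f y = f x + n.

Lemma f_mono a b : a <= b -> f a <= f b.
Proof.
by move=> /subnK<-; elim: (b - a) => // k IH; rewrite addSn (leq_trans IH).
Qed.

(** Periodicity gives f (a + n) = a + 1 + n, so by monotonicity no interval starting before a + 1 +
    n passes that point. *)
Lemma heredity_pd0 a : f a = a.+1 -> heredity a.+1.
Proof.
move=> fa; have fan : f (a + n) = a.+1 + n by rewrite f_per fa.
split; first by rewrite -fan f_mono //; lia.
by move=> y /andP[_ lty]; left; rewrite -fan f_mono //; lia.
Qed.

(** With x = f a: up to a + n monotonicity gives f y <= x + n; beyond it f y is squeezed between f
    (a + 1) + n and f (f a) + n, which are equal. *)
Lemma heredity_pd2 a : f a.+1 = f (f a) -> heredity (f a).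
Proof.
move=> fa; have fan := f_per a; have fan1 := f_per a.+1.
split; first by rewrite -fa -fan f_mono //; lia.
move=> y /andP[_ lty]; have [le|lt] := leqP y (a + n).
  by left; rewrite -fan f_mono.
right; rewrite -fa -fan1; apply/eqP; rewrite eqn_leq (f_mono (a := a.+1 + n)) ?andbT; last by lia.
by rewrite fan1 fa -f_per f_mono // ltnW.
Qed.

(** If f were strictly increasing, a < b < f a would give b < f a < f b: the syzygy of a
    non-projective interval would never be projective. *)
Lemma step_flat k a b : interval_pd k a b -> a < b -> b < f a ->
  exists x, f x = f x.+1.
Proof.
move=> pdab ltab ltbf; apply: contrapT => /forallNP H.
have f_inc x y : x < y -> f x < f y.
  move=> ltxy; apply: leq_trans (f_mono ltxy).
  by rewrite ltn_neqAle f_step andbT; apply/eqP.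
elim: k a b ltab ltbf pdab => [|k IH] a b ltab ltbf /=; rewrite ltn_eqF //=.
by apply: IH => //; exact: f_inc.
Qed.

Lemma step_jump : exists x, f x < f x.+1.
Proof.
apply: contrapT => /forallNP H.
have const k : f k = f 0.
  elim: k => // k IH; apply/eqP; rewrite -IH eqn_leq f_step andbT leqNgt.
  exact/negP.
by have := f_per 0; rewrite add0n const; lia.
Qed.

End IntervalCombinatorics.

Section Kupisch.
Variables (K : fieldType) (A : falgType K) (I : finType) (S P : I -> rmod A).
Variable p : forall i, rhom (P i) (S i).
Hypothesis SP : simple_covers p.
Variables (c : I -> nat) (R : forall i, nat -> {vspace (P i)}).
Hypothesis cR : forall i, radical_series (c i) (R i).
Variables (s : I -> I) (i0 : I).
Hypotheses (s_inj : injective s) (s_conn : forall i j, fconnect s i j).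
Hypothesis s_lay : forall i k, (k < c i)%N ->
  exists f : rhom (P (iter k s i)) (P i), limg f = R i k.
Implicit Types M N : rmod A.

Let n := #|I|.
Definition vertex a := iter a s i0.
(* P_a is the interval module [a, kup a). *)
Definition kup a := (a + c (vertex a))%N.
Notation v := vertex.
Notation f := kup.

Lemma orderE i : order s i = n.
Proof. by apply: eq_card => j; rewrite inE s_conn. Qed.

Lemma index_gt0 : (0 < n)%N. Proof. by apply/card_gt0P; exists i0. Qed.

Lemma vertexD a k : v (a + k) = iter k s (v a).
Proof. by rewrite /vertex addnC iterD. Qed.

Lemma vertex_per a : v (a + n) = v a.
Proof. by rewrite vertexD -(orderE (v a)) iter_order. Qed.

Lemma vertex_ex x i : exists2 y, (x <= y < x + n)%N & v y = i.
Proof.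
exists (x + findex s (v x) i)%N.
  by rewrite leq_addr ltn_add2l -(orderE (v x)) findex_max.
by rewrite vertexD iter_findex.
Qed.

Lemma vertex_inj x a b : (x <= a < x + n)%N -> (x <= b < x + n)%N ->
  v a = v b -> a = b.
Proof.
move=> /andP[xa ax] /andP[xb bx].
rewrite -(subnKC xa) -(subnKC xb) !vertexD => e; congr (_ + _)%N.
have lt d : (x <= d < x + n)%N -> (d - x < order s (v x))%N by rewrite orderE; lia.
by rewrite -(findex_iter (lt a _)) ?xa // e findex_iter // lt ?xb.
Qed.

Lemma layer a k j : (k < c (v a))%N -> v (a + k) = j ->
  exists g : rhom (P j) (P (v a)), limg g = R (v a) k.
Proof. by move=> ltk <-; rewrite vertexD; exact: s_lay. Qed.

Lemma kup_gt a : (a < f a)%N.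
Proof. by rewrite /kup -[X in (X < _)%N]addn0 ltn_add2l (len_gt0 SP cR). Qed.

(** When nonzero, the radical of P_a is a quotient of P_(a+1), which bounds its length. *)
Lemma kup_step a : (f a <= f a.+1)%N.
Proof.
rewrite /kup; have [le|lt] := leqP (c (v a)) 1.
  by have := len_gt0 SP cR (v a.+1); lia.
have [g gR] := layer lt (erefl _).
have [_] := rs_ker (cR _) (cR _) gR (ltnW lt).
by rewrite addn1; lia.
Qed.

Lemma kup_per a : f (a + n) = (f a + n)%N.
Proof. by rewrite /kup vertex_per addnAC. Qed.

Let f_mono := f_mono kup_step.

Definition interval_mod a b M : Prop :=
  [/\ (a <= b)%N, (b <= f a)%N &
      exists g : rhom (P (v a)) M, limg g = fullv /\ lker g = R (v a) (b - a)].

Lemma interval_simple a : interval_mod a a.+1 (S (v a)).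
Proof.
split; [exact: leqnSn | exact: kup_gt |].
by exists (p (v a)); rewrite (sc_epi SP) (ker_top SP cR) subSnn.
Qed.

(** The kernel is the radical power at depth b - a; its top is the vertex b, so it is a quotient of
    P_b and ends where P_a does. *)
Lemma interval_syzygy a b M N (g : rhom (P (v a)) M) (i : rhom N (P (v a))) :
  (a <= b < f a)%N -> lker g = R (v a) (b - a) -> lker i = 0%VS -> limg i = lker g ->
  interval_mod b (f a) N.
Proof.
move=> /andP[ab bfa] gR i0' ig.
have ltk : (b - a < c (v a))%N by rewrite ltn_subLR.
have [|h hR] := layer (j := v b) ltk; first by rewrite subnKC.
have [kh _] := rs_ker (cR _) (cR _) hR (ltnW ltk).
have [|h' hE] := factor_mono i0' (f := h); first by rewrite hR ig gR.
split; [exact: ltnW | exact: f_mono | exists h'; split].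
  apply/eqP; rewrite -(eq_limg_ker0 _ _ (introT eqP i0')) ig gR -hR.
  by rewrite -limg_rcomp; apply/eqP/eq_in_limg => x _; rewrite rcompE.
have -> : (f a - b = c (v a) - (b - a))%N by rewrite /kup; lia.
rewrite -kh; apply/vspaceP => x; rewrite !memv_ker -hE.
by rewrite -[X in (_ = (_ == X))](linear0 i) (inj_eq ((lker0_inj i).1 i0')).
Qed.

(** If [a, b) is projective, its cover splits; in the uniserial P_a one of the two complements
    vanishes, and a < b leaves only the kernel. Higher [k] follow by taking syzygies. *)
Lemma pd_interval k a b M : (a < b)%N -> interval_mod a b M ->
  (pd k M <-> interval_pd f k a b).
Proof.
elim: k a b M => [|k IH] a b M ltab /[dup] IM [leab lebf [g [gf gR]]].
  rewrite /= orbF; split=> [pM|/eqP bE]; last first.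
    have g0 : lker g = 0%VS by rewrite gR (rs_ge (cR _)) // bE /kup addKn.
    have [h [hg gh]] := rmod_iso_inv g0 gf.
    exact: proj_retract (sc_proj SP (v a)) gh.
  have [h gh] := proj_split pM gf.
  have hg : (limg h :&: lker g)%VS = 0%VS.
    apply/eqP; rewrite -subv0; apply/subvP => x.
    by rewrite memv_cap => /andP[/limgP[m ->]]; rewrite memv_ker gh => /eqP->; rewrite linear0 mem0v.
  have [le|le] := rs_total (cR (v a)) (submod_limg h) (submod_ker g).
    have h0 : limg h = 0%VS by move/capv_idPl: le => <-.
    have : lker g = fullv.
      by apply/lkerfP => x; rewrite -[LHS]gh ((limg0P h).1 h0) linear0.
    rewrite gR -(rs0 (cR _)) => /(rs_eq (cR (v a))) H.
    have : (b - a)%N = 0%N by apply: H; rewrite ?leq_subLR.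
    by move/eqP; rewrite subn_eq0 leqNgt ltab.
  have /eqP : lker g = 0%VS by move/capv_idPr: le => <-.
  rewrite gR (rs_eq0 (cR _)) => lec; rewrite eqn_leq lebf /=.
  by rewrite /kup -(leq_subRL _ leab).
have [N [i [i0' ig]]] := sub_exists (submod_ker g).
move: lebf; rewrite /= leq_eqVlt => /orP[/eqP bE|ltbf].
  rewrite bE eqxx /=; split=> // _; apply: (@pd_leq _ _ 0 k.+1) => //.
  have g0 : lker g = 0%VS by rewrite gR (rs_ge (cR _)) // bE /kup addKn.
  have [h [hg gh]] := rmod_iso_inv g0 gf.
  exact: proj_retract (sc_proj SP (v a)) gh.
rewrite ltn_eqF //=.
have IN := interval_syzygy (introT andP (conj leab ltbf)) gR i0' ig.
rewrite -(IH _ _ _ ltbf IN); split; first exact: pd_schanuel (sc_proj SP _) gf i0' ig.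
by move=> pN; exists (P (v a)), g, N, i; split=> //; exact: (sc_proj SP).
Qed.

Lemma pd_simple k a : pd k (S (v a)) <-> interval_pd f k a a.+1.
Proof. exact: pd_interval (leqnn _) (interval_simple a). Qed.

Lemma pdim_eqP M k : pdim_eq M k <-> pd k M /\ forall m, pd m M -> (k <= m)%N.
Proof.
by split=> -[/pdim_leP kM min]; split=> // m; [move=> /pdim_leP/min | move=> /pdim_leP/min].
Qed.

Lemma simple_pdimsP k : simple_pdims A k <->
  exists a, pd k (S (v a)) /\ forall m, pd m (S (v a)) -> (k <= m)%N.
Proof.
split=> [[T sT /pdim_eqP[kT min]]|[a kS]]; last first.
  by exists (S (v a)); [exact: sc_simple SP _ | exact/pdim_eqP].
have [i Ti] := sc_all SP sT; have [a _ aE] := vertex_ex 0 i; exists a.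
rewrite aE; split; first exact: pd_iso Ti kT.
by move=> m /(pd_iso (rmod_iso_sym Ti))/min.
Qed.

(** * S-connectedness and heredity vertices *)

Notation heredity := (heredity n f).

Lemma S_connected_heredity : S_connected A -> exists x, heredity x.
Proof.
move=> [[N fin] int].
have fs := kup_step; have fp := kup_per; have n0 := index_gt0.
have [[a fa]|/forallNP nfa] := pselect (exists a, f a = a.+1).
  by exists a.+1; exact: heredity_pd0.
have fgt a : (a.+1 < f a)%N by rewrite ltn_neqAle kup_gt andbT; apply/eqP/nesym/nfa.
have fin' a : pd N (S (v a)) by exact/pdim_leP/fin.
(* At a flat step the radical of P_a is P_(a+1), so with no simple projective the dimension is
   exactly 1. *)
have [a1 fa1] : exists a, f a = f a.+1.
  apply: (step_flat fs (k := N) (a := 0) (b := 1)) => //; last exact: fgt.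
  exact: (pd_simple N 0).1 (fin' 0%N).
have one : simple_pdims A 1.
  apply/simple_pdimsP; exists a1; split.
    by apply/pd_simple; rewrite /= fa1 eqxx orbT.
  by case=> // /pd_simple; rewrite /= ltn_eqF.
(* At a jump the radical is not projective, so the dimension is at least 2; with the value 1 already
   taken, the interval property yields 2. *)
have [a2 fa2] := step_jump n0 fs fp.
have exk : exists k, `[< pd k (S (v a2)) >] by exists N; apply/asboolP.
have two : simple_pdims A 2.
  case: (ex_minnP exk) => k /asboolP pk min.
  apply: (int 1 k 2) => //.
    apply/simple_pdimsP; exists a2; split=> // m pm; apply: min; exact/asboolP.
  case: k pk {min} => [|[|k]] // /pd_simple.
    by rewrite /= (ltn_eqF (fgt a2)).
  by rewrite /= (ltn_eqF (fgt a2)) (ltn_eqF fa2).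
have [a [/pd_simple /= pa min]] := (simple_pdimsP 2).1 two.
exists (f a); apply: heredity_pd2 => //.
move: pa; rewrite ltn_eqF //= orbF => /orP[/eqP e|/eqP//].
have : pd 1 (S (v a)) by apply/pd_simple; rewrite /= e eqxx orbT.
by move/min.
Qed.

Section Heredity.
Variable x : nat.
Hypothesis Hx : heredity x.

(** The syzygy of S_y is [y + 1, f y). If f y <= x + n, its factors are simples at later z in the
    window. Otherwise f y = f x + n = f (y + 1), so the syzygy is zero or projective. *)
Lemma heredity_pd_step m y : (x <= y < x + n)%N ->
  (forall z, (y < z < x + n)%N -> pd m (S (v z))) -> pd m.+1 (S (v y)).
Proof.
move=> /andP[lexy ltyx] pdz; have [fx fy] := Hx.
have [lef|gtf] := leqP (f y) (x + n); last first.
  have ltxy : (x < y)%N.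
    by rewrite ltn_neqAle lexy andbT; apply: contraTneq gtf => <-; rewrite -leqNgt.
  have fyE : f y = (f x + n)%N by case: (fy y) => //; [rewrite ltxy | lia].
  have fy1 : f y.+1 = f y.
    (* For the last vertex y + 1 = x + n is outside the range of [Hx], and periodicity supplies the
       value. *)
    rewrite fyE; have := kup_step y; rewrite leq_eqVlt in ltyx.
    case/orP: ltyx => [/eqP->|lty _ ]; first by rewrite kup_per.
    by case: (fy y.+1) => //; rewrite ?lty ?ltnS //; have := kup_step y; lia.
  by apply: (@pd_leq _ _ 1) => //; apply/pd_simple; rewrite /= fy1 eqxx orbT.
have [N [i [i0' ig]]] := sub_exists (submod_ker (p (v y))).
exists (P (v y)), (p (v y)), N, i; split=> //; [exact: (sc_proj SP) | exact: (sc_epi SP) |].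
apply: (pd_simples SP) => j h nzh.
have [t _ tR] := rs_ex (cR (v y)) (submod_limg (rcomp i h)).
have ltt : (t < c (v y))%N.
  rewrite ltnNge -(rs_eq0 (cR _)) -tR; apply/eqP => /limg0P ih; apply: nzh.
  by apply/limg0P => u; apply: ((lker0_inj i).1 i0'); rewrite -rcompE ih linear0.
have gt0 : (0 < t)%N.
  have : (limg (rcomp i h) <= R (v y) 1)%VS.
    by rewrite -(ker_top SP cR) -ig limg_rcomp limgS ?subvf.
  by rewrite tR (rs_sub (cR _)) => /orP[//|]; rewrite leqNgt ltt.
have [g gR] := layer ltt (erefl _).
have -> : j = v (y + t) by exact: layer_unique SP _ _ _ (cR (v y)) _ _ _ (rcomp i h) g ltt tR gR.
by apply: pdz; move: lef; rewrite /kup; lia.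
Qed.

Lemma heredity_pd_le y : (x <= y < x + n)%N -> pd n (S (v y)).
Proof.
move=> yP; apply: (@pd_leq _ _ (x + n - y)); first lia.
move eqd : (x + n - y)%N => d.
elim/ltn_ind: d y yP eqd => -[|d] IH y yP eqd; first by lia.
apply: heredity_pd_step => // z zP.
by apply: (@pd_leq _ _ (x + n - z)); [lia | apply: IH => //; lia].
Qed.

(** To reach [k.+1], take the last [y] in the window whose simple has dimension above [k]: all later
    ones are at most [k], so [heredity_pd_step] makes this one exactly [k.+1]. A value 0 in the
    range must be [i] itself. *)
Lemma heredity_S_connected : S_connected A.
Proof.
split.
  exists n => M; apply/pdim_leP/(pd_simples SP) => i _ _.
  by have [y yP <-] := vertex_ex x i; exact: heredity_pd_le.
move=> i j [|k] sci scj /andP[leik lekj].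
  by move: leik sci; rewrite leqn0 => /eqP->.
have [a [pa mina]] := (simple_pdimsP j).1 scj.
have [b bP bE] := vertex_ex x (v a).
pose bad y := (x <= y < x + n)%N && ~~ `[< pd k (S (v y)) >].
have exbad : exists y, bad y.
  exists b; rewrite /bad bP /= bE; apply/asboolP => /mina; lia.
have bound y : bad y -> (y <= x + n)%N by case/andP; lia.
case: (ex_maxnP exbad bound) => y /andP[yP /asboolP npy] max.
apply/simple_pdimsP; exists y; split.
  apply: heredity_pd_step => // z zP; apply: contrapT => /asboolPn npz.
  by have := max z; rewrite /bad npz; lia.
move=> m pm; rewrite ltnNge; apply/negP => lemk; apply: npy.
exact: pd_leq pm.
Qed.

End Heredity.

End Kupisch.

(** * Heredity and quasi-hereditary structures *)

Section Filtrations.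
Variables (K : fieldType) (A : falgType K).
Implicit Types M N P T : rmod A.

Lemma filtration_hit (F : rmod A -> Prop) M (W : {vspace M}) P (f : rhom P M) :
  filtered_by F W -> (limg f <= W)%VS -> limg f <> 0%VS ->
  exists U V N, [/\ F N, is_submod V, factor_iso U V N,
                    (limg f <= V)%VS & ~~ (limg f <= U)%VS].
Proof.
case=> s [<- sub fac] fW nzf; apply: contrapT => H.
suff stay k : (k <= size s)%N -> ~~ (limg f <= nth 0%VS (0%VS :: s) k)%VS.
  by have := stay _ (leqnn _); rewrite -last_nth fW.
elim: k => [_|k IH ltk]; first by rewrite subv0; apply/eqP.
apply/negP => le; have [N FN facN] := fac k ltk; apply: H.
exists (nth 0%VS (0%VS :: s) k), (nth 0%VS s k), N; split=> //.
  exact/sub/mem_nth.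
exact/IH/ltnW.
Qed.

Lemma factor_hom M (U V : {vspace M}) N : is_submod V -> factor_iso U V N ->
  exists E (e : rhom E M) (g : rhom E N),
    [/\ lker e = 0%VS, limg e = V, limg g = fullv & (e @: lker g)%VS = U].
Proof.
move=> sV [g0 [g0act g0f UV Uk]]; have [E [e [e0 eV]]] := sub_exists sV.
have eE x : e x \in V by rewrite -eV memv_img ?memvf.
have rg : @is_rhom _ _ E N (g0 \o e)%VF.
  by move=> a x; rewrite !comp_lfunE rhom_act g0act.
exists E, e, (Rhom rg); split=> //; first by rewrite /= limg_comp eV.
rewrite -Uk; apply/vspaceP => y; rewrite memv_cap; apply/memv_imgP/andP.
  by case=> x; rewrite !memv_ker comp_lfunE => gx ->.
case; rewrite -eV => /limgP[x ->]; rewrite memv_ker => gx.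
by exists x; rewrite // memv_ker comp_lfunE.
Qed.

(** At the first term containing the image of [f], the map becomes nonzero in the factor: this is
    how a composition factor of [W] is located in a member of [F]. *)
Lemma filtration_hom (F : rmod A -> Prop) M (W : {vspace M}) P (f : rhom P M) :
  filtered_by F W -> (limg f <= W)%VS -> limg f <> 0%VS ->
  exists E N V (e : rhom E M) (g : rhom E N) (h : rhom P E),
    [/\ F N, limg e = V, lker e = 0%VS, limg g = fullv &
     [/\ forall x, e (h x) = f x & limg (rcomp g h) <> 0%VS]].
Proof.
move=> FW fW nzf; have [U [V [N [FN sV facN fV nfU]]]] := filtration_hit FW fW nzf.
have [E [e [g [e0 eV gf eU]]]] := factor_hom sV facN.
have [|h hE] := factor_mono e0 (f := f); first by rewrite eV.
exists E, N, V, e, g, h; split=> //; split=> // gh0; case/negP: nfU.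
apply/limg_subP => x; rewrite -hE -eU memv_img // memv_ker -rcompE.
by rewrite ((limg0P (rcomp g h)).1 gh0).
Qed.

End Filtrations.

Section FromQuasiHereditary.
Variables (K : fieldType) (A : falgType K) (I : finType) (S P Delta : I -> rmod A).
Variable p : forall i, rhom (P i) (S i).
Hypothesis SP : simple_covers p.
Variables (c : I -> nat) (R : forall i, nat -> {vspace (P i)}).
Hypothesis cR : forall i, radical_series (c i) (R i).
Variables (s : I -> I) (i0 : I).
Hypotheses (s_inj : injective s) (s_conn : forall i j, fconnect s i j).
Hypothesis s_lay : forall i k, (k < c i)%N ->
  exists f : rhom (P (iter k s i)) (P i), limg f = R i k.
Variables (lti : I -> I -> Prop).
Variables (q : forall i, rhom (P i) (Delta i)) (r : forall i, rhom (Delta i) (S i)).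
Hypothesis lti_irr : forall i, ~ lti i i.
Hypothesis i0_max : forall i, ~ lti i0 i.
Hypothesis q_epi : forall i, limg (q i) = fullv.
Hypothesis rq : forall i x, r i (q i x) = p i x.
Hypothesis r_fil : forall i,
  filtered_by (fun N => exists2 j, lti j i & rmod_iso N (S j)) (lker (r i)).
Hypothesis q_fil : forall i,
  filtered_by (fun N => exists2 j, lti i j & rmod_iso N (Delta j)) (lker (q i)).

Notation v := (vertex s i0).
Notation f := (kup c s i0).
Notation n := #|I|.

Lemma vertex0 : v 0 = i0. Proof. by []. Qed.

Lemma hom_ker_r i j (g : rhom (P i) (Delta j)) :
  (limg g <= lker (r j))%VS -> limg g <> 0%VS -> lti i j.
Proof.
move=> gr nzg.
have [E [N [V [e [t [h [[l ltlj Nl] _ _ _ [_ nzth]]]]]]]] := filtration_hom (r_fil j) gr nzg.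
have sN := simple_iso (sc_simple SP l) (rmod_iso_sym Nl).
have iN := cover_top (sc_simple SP i) (sc_cover SP i) sN nzth.
by rewrite (sc_inj SP (rmod_iso_trans iN Nl)).
Qed.

(** A factor S_i0 of [Delta j] is either its top, whence [j = i0], or lies in the kernel of [r j],
    which would put [i0] strictly below [j]. *)
Lemma hom_top_Delta j (g : rhom (P i0) (Delta j)) : limg g <> 0%VS -> j = i0.
Proof.
move=> nzg; have [rg0|nzrg] := pselect (limg (rcomp (r j) g) = 0%VS).
  case: (@i0_max j); apply: (hom_ker_r (g := g)) => //.
  by rewrite lkerE -limg_rcomp rg0.
apply: esym; apply: (sc_inj SP).
by apply: (cover_top _ (sc_cover SP i0) _ nzrg); exact: (sc_simple SP).
Qed.

(** By maximality of [i0] there is no admissible filtration factor, so the filtration of the kernel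
    is empty. *)
Lemma Delta_top : lker (q i0) = 0%VS.
Proof.
have [t [<- _ fac]] := q_fil i0; case: t fac => [|U t] //= fac.
by have [N [j /i0_max]] := fac 0%N isT.
Qed.

(* The image of g lies in the radical of P i, so g composed with q i misses  *)
(* the top of Delta i.                                                       *)
Lemma hom_radical_ker i j k (g : rhom (P j) (P i)) : limg g = R i k -> (0 < k)%N ->
  limg (rcomp (q i) g) <> 0%VS -> lti j i.
Proof.
move=> gR k0; apply: hom_ker_r; apply/limg_subP => x.
rewrite memv_ker rcompE rq -memv_ker (ker_top SP cR).
by apply: (subvP (rs_mono (cR i) k0)); rewrite -gR memv_img ?memvf.
Qed.

(** If f 0 > n, then S_i0 recurs in the radical of P_i0 = Delta_i0, against irreflexivity. If f y >
    n, then S_i0 occurs in P_y at depth n - y. By maximality it lies in the kernel of [q], inside a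
    factor isomorphic to Delta_i0 = P_i0; projectivity turns this factor into a submodule of P_y. *)
Lemma quasi_hereditary_heredity : heredity n f 0.
Proof.
have n0 := index_gt0 i0.
have per := vertex_per i0 s_inj s_conn.
have vn : v (0 + n) = i0 by rewrite per.
split.
  rewrite /kup !add0n leqNgt; apply/negP => ltnc.
  have [g gR] := layer s_lay (a := 0) ltnc vn.
  apply: (lti_irr (i := i0)); apply: (hom_radical_ker gR n0).
  move/limg0P => qg; move: ltnc; rewrite ltnNge -(rs_eq0 (cR _)) -gR => /eqP; apply.
  by apply/limg0P => x; apply: ((lker0_inj (q i0)).1 Delta_top); rewrite -rcompE qg linear0.
move=> y /andP[y0 yn]; have [lef|gtf] := leqP (f y) (0 + n); [by left | right].
have ltk : (n - y < c (v y))%N by move: gtf; rewrite /kup; lia.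
have [|g gR] := layer s_lay (j := i0) ltk; first by rewrite subnKC // ltnW.
have nzg : limg g <> 0%VS.
  by rewrite gR; apply/eqP; rewrite (rs_eq0 (cR _)) -ltnNge.
have qg0 : limg (rcomp (q (v y)) g) = 0%VS.
  by apply: contrapT => /(hom_radical_ker gR); rewrite subn_gt0 => /(_ yn)/i0_max.
have gq : (limg g <= lker (q (v y)))%VS by rewrite lkerE -limg_rcomp qg0.
have [E [N [V [e [t [h [[j _ Nj] eV e0 tf [eh nzth]]]]]]]] := filtration_hom (q_fil _) gq nzg.
have [d [d0 df]] := (rmod_isoP _ _).1 Nj.
have ji0 : j = i0.
  apply: (hom_top_Delta (g := rcomp d (rcomp t h))) => /limg0P dth; apply: nzth.
  by apply/limg0P => x; apply: ((lker0_inj d).1 d0); rewrite -rcompE dth linear0.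
rewrite {}ji0 in Nj d d0 df.
have [q' [q'q qq']] := rmod_iso_inv Delta_top (q_epi i0).
pose w := rcomp q' (rcomp d t).
have wf : limg w = fullv.
  apply/limg_fullP => x; have /limg_fullP/(_ (q i0 x))[z zE] := df.
  have /limg_fullP/(_ z)[u uE] := tf.
  by exists u; rewrite !rcompE -uE -zE q'q.
have [b wb] := proj_split (sc_proj SP i0) wf.
have bw : (limg b :&: lker w)%VS = 0%VS.
  apply/eqP; rewrite -subv0; apply/subvP => x.
  by rewrite memv_cap => /andP[/limgP[m ->]]; rewrite memv_ker wb => /eqP->; rewrite linear0 mem0v.
(* [E] splits as [limg b] plus [lker w]; inside the uniserial P_y one of them must vanish, and
   [limg b] cannot. *)
have w0 : lker w = 0%VS.
  have [|] := rs_total (cR (v y)) (submod_img e (submod_limg b)) (submod_img e (submod_ker w));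
    rewrite limg_ker0 ?e0 //; last by move/capv_idPr => <-.
  move/capv_idPl; rewrite bw => /esym b0; apply: contrapT => _.
  apply: (sc_simple SP i0).1; rewrite -(sc_epi SP i0); apply/limg0P => x.
  by rewrite -[x]wb ((limg0P b).1 b0) !linear0.
have bf : limg b = fullv.
  apply/limg_fullP => x; exists (w x); apply: ((lker0_inj w).1 w0).
  by rewrite wb.
have [m mc VR] := rs_ex (cR (v y)) (submod_limg e).
have ebR : limg (rcomp e b) = R (v y) m by rewrite limg_rcomp bf VR.
have [kb cle] := rs_ker (cR _) (cR _) ebR mc.
have lek : (m <= n - y)%N.
  have : (limg g <= limg e)%VS by apply/limg_subP => x; rewrite -eh memv_img ?memvf.
  by rewrite gR VR (rs_sub (cR _)) [(c _ <= _)%N]leqNgt ltk orbF.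
have ltm : (m < c (v y))%N by exact: leq_ltn_trans ltk.
have [g' g'R] := layer s_lay ltm (erefl _).
have e1 : i0 = v (y + m) by exact: layer_unique SP _ _ _ (cR (v y)) _ _ _ (rcomp e b) g' ltm ebR g'R.
(* Both y + m and n lie in the window from 1 to n and carry the vertex [i0]. *)
have ymn : (y + m = n)%N.
  apply: (vertex_inj s_conn (x := 1) (i0 := i0)); [lia | lia |].
  by rewrite -e1 -[n]add0n per.
(* Injectivity bounds the length of P_i0 by that of the submodule at depth [m]; with [cle] they are
   equal, which reads f y = f 0 + n. *)
have : lker (rcomp e b) = 0%VS.
  apply/lker0_inj => x1 x2; rewrite !rcompE => /((lker0_inj e).1 e0) bx.
  by rewrite -[x1]wb bx wb.
rewrite kb => /eqP; rewrite (rs_eq0 (cR _)) /kup vertex0.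
by lia.
Qed.

End FromQuasiHereditary.

Section ToQuasiHereditary.
Variables (K : fieldType) (A : falgType K) (I : finType) (S P : I -> rmod A).
Variable p : forall i, rhom (P i) (S i).
Hypothesis SP : simple_covers p.
Variables (c : I -> nat) (R : forall i, nat -> {vspace (P i)}).
Hypothesis cR : forall i, radical_series (c i) (R i).
Variables (s : I -> I) (i0 : I).
Hypotheses (s_inj : injective s) (s_conn : forall i j, fconnect s i j).
Hypothesis s_lay : forall i k, (k < c i)%N ->
  exists f : rhom (P (iter k s i)) (P i), limg f = R i k.

Notation v := (vertex s i0).
Notation f := (kup c s i0).
Notation n := #|I|.

Variable x : nat.
Hypothesis Hx : heredity n f x.

(* Reversed, so that the heredity vertex x comes last in the order of 'I_n. *)
Let pos (k : 'I_n) := (x + (n.-1 - k))%N.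
Let w k := v (pos k).

Lemma pos_bounds k : (x <= pos k < x + n)%N.
Proof. by rewrite /pos; have := ltn_ord k; lia. Qed.

(** Since [pos k + k.+1 = x + n], dividing by the radical power [k.+1] cuts P_y, for y = [pos k], at
    x + n. *)
Lemma quotient_exists (k : 'I_n) : exists D (q : rhom (P (w k)) D) (r : rhom D (S (w k))),
  [/\ limg q = fullv, lker q = R (w k) k.+1 & forall z, r (q z) = p (w k) z].
Proof.
have [D [q [qf qR]]] := quo_exists (rs_submod (cR (w k)) k.+1).
have [|r rq] := factor_epi (f := p (w k)) qf.
  by rewrite qR (ker_top SP cR) (rs_mono (cR _)).
by exists D, q, r.
Qed.

Section Quotients.
Variables (Delta : 'I_n -> rmod A) (q : forall k, rhom (P (w k)) (Delta k)).
Variable (r : forall k, rhom (Delta k) (S (w k))).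
Hypothesis q_epi : forall k, limg (q k) = fullv.
Hypothesis q_ker : forall k, lker (q k) = R (w k) k.+1.
Hypothesis rq : forall k z, r k (q k z) = p (w k) z.

Lemma ker_r_filtration (k : 'I_n) :
  filtered_by (fun N => exists2 j : 'I_n, (j < k)%N & rmod_iso N (S (w j)))
    (lker (r k)).
Proof.
(* [m] is the length of [Delta k]. *)
have [m [m0 mk mc mE]] : exists m, [/\ (0 < m)%N, (m <= k.+1)%N, (m <= c (w k))%N
    & (k < m)%N || (c (w k) <= m)%N].
  by exists (minn k.+1 (c (w k))); have := len_gt0 SP cR (w k); split; lia.
pose W i := (q k @: R (w k) (m - i))%VS.
pose t := mkseq (fun i => W i.+1) m.-1.
have W0 : W 0%N = 0%VS.
  apply/eqP; by rewrite /W subn0 -lkerE q_ker (rs_sub (cR _)).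
have tW i : (i <= m.-1)%N -> nth 0%VS (0%VS :: t) i = W i.
  by case: i => [|i] lti /=; [rewrite W0 | rewrite nth_mkseq].
have kerr : lker (r k) = W m.-1.
  rewrite /W (_ : m - m.-1 = 1)%N; last by lia.
  rewrite -(ker_top SP cR); apply/vspaceP => z; apply/idP/memv_imgP.
    have /limg_fullP/(_ z)[u ->] := q_epi k.
    by rewrite memv_ker rq => pu; exists u; rewrite // memv_ker.
  by case=> u; rewrite !memv_ker => pu ->; rewrite rq.
exists t; split.
- by rewrite kerr -tW // (last_nth 0%VS) size_mkseq.
- by move=> U /mapP[i _ ->]; apply/submod_img/(rs_submod (cR _)).
move=> i; rewrite size_mkseq => ltim.
have ltu : (m.-1 - i < c (w k))%N by lia.
have ltk := ltn_ord k.
have ltj : (k - (m.-1 - i) < n)%N by lia.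
(* The factor of [W i.+1] by [W i] is layer [m.-1 - i]; in the reversed numbering, going down one
   layer lowers the index by one. *)
pose j := Ordinal ltj.
have [|g gR] := layer s_lay (j := w j) ltu.
  congr (vertex _ _ _); rewrite /pos /=; move: #|I| (nat_of_ord k) ltk mk => N a; lia.
exists (S (w j)).
  by exists j; [rewrite /=; move: (nat_of_ord k) mk => a; lia | exact: rmod_iso_refl].
rewrite tW 1?ltnW // nth_mkseq //.
have -> : W i = (rcomp (q k) g @: lker (p (w j)))%VS.
  rewrite (ker_top SP cR) /= limg_comp (rs_img (cR _) (cR _) gR) /W.
  by congr (_ @: R _ _)%VS; lia.
have -> : W i.+1 = limg (rcomp (q k) g).
  by rewrite limg_rcomp gR /W; congr (_ @: R _ _)%VS; lia.
apply: factor_iso_cover; first exact: sc_epi SP _.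
apply: (cover_radical (sc_simple SP _) (sc_cover SP _) (submod_ker _)) => /lkerfP/limg0P.
rewrite limg_rcomp gR => /eqP; rewrite -lkerE q_ker (rs_sub (cR _)).
by lia.
Qed.

(** The kernel is the tail of P_y from x + n on, where y = [pos k]. If it is nonzero, heredity gives
    f y = f x + n, so it is a copy of P_x, and P_x is the standard module of the last index because
    f x <= x + n. *)
Lemma ker_q_filtration (k : 'I_n) :
  filtered_by (fun N => exists2 j : 'I_n, (k < j)%N & rmod_iso N (Delta j))
    (lker (q k)).
Proof.
rewrite q_ker; have [le|lt] := leqP (c (w k)) k.+1.
  by exists [::]; split; rewrite // (rs_ge (cR _) le).
have [fx fy] := Hx; have ltk := ltn_ord k.
have fpos : (x + n < f (pos k))%N by rewrite /kup -/(w k) /pos; lia.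
have ltx : (x < pos k)%N.
  have := pos_bounds k; rewrite leq_eqVlt => /andP[/orP[/eqP e|//] _].
  by move: fpos; rewrite -e ltnNge fx.
have fE : f (pos k) = (f x + n)%N.
  case: (fy (pos k)) => // [|le]; first by rewrite ltx; case/andP: (pos_bounds k).
  by rewrite leqNgt fpos in le.
have ltj : (n.-1 < n)%N by lia.
pose j := Ordinal ltj.
have wj : w j = v x by rewrite /w /pos /= subnn addn0.
have wxn : v (pos k + k.+1) = w j.
  rewrite wj -(vertex_per i0 s_inj s_conn x); congr (vertex _ _ _).
  by rewrite /pos; lia.
have [g gR] := layer s_lay lt wxn.
exists [:: R (w k) k.+1]; split=> //.
  by move=> U; rewrite inE => /eqP->; exact: rs_submod (cR _) _.
case=> // _; exists (Delta j).
  by exists j; [move: ltx; rewrite /pos /=; lia | exact: rmod_iso_refl].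
have q0 : lker (q j) = 0%VS.
  by rewrite q_ker (rs_ge (cR _)) // wj /= (ltn_predK ltk) -(leq_add2l x).
have [g0 _] := rs_ker (cR _) (cR _) gR (ltnW lt).
rewrite /= -[X in factor_iso X](limg0 g) -q0 -gR.
apply: factor_iso_cover => //.
(* Injectivity of [g]: by [fE], the length of P_x does not exceed the length of the tail. *)
have arith N a b d : (a < N)%N -> (x + (N.-1 - a) + b = x + d + N)%N -> (d <= b - a.+1)%N.
  lia.
by rewrite g0 (rs_ge (cR _)) ?sub0v // wj (arith n) //; exact: fE.
Qed.

Lemma quotients_quasi_hereditary : quasi_hereditary A.
Proof.
exists _, 'I_n, (fun k => S (w k)), (fun k => P (w k)), Delta.
exists (fun k => rlf (p (w k))), (fun k => rlf (q k)), (fun k => rlf (r k)).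
have p_epi k := sc_epi SP (w k).
split=> [k|k l /(sc_inj SP) wkl|T sT|k|k].
- exact: sc_simple SP _.
- have := vertex_inj s_conn (pos_bounds k) (pos_bounds l) wkl.
  have arith N a b : (a < N)%N -> (b < N)%N -> (x + (N.-1 - a) = x + (N.-1 - b))%N -> a = b.
    lia.
  by move/(arith n k l (ltn_ord k) (ltn_ord l))/val_inj.
- have [i Ti] := sc_all SP sT; have [y yP yE] := vertex_ex i0 s_conn x i.
  have arith N : (x <= y < x + N)%N ->
      (N.-1 - (y - x) < N)%N /\ (x + (N.-1 - (N.-1 - (y - x))))%N = y by lia.
  have [ltj jE] := arith _ yP.
  by exists (Ordinal ltj); rewrite /w /pos /= jE yE.
- exact: sc_cover SP _.
split.
- by split; [exact: rhomP | exact: q_epi].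
- split; [exact: rhomP | apply/limg_fullP => z].
  have /limg_fullP/(_ z)[u ->] := p_epi k.
  by exists (q k u); rewrite rq.
- by apply/lfunP => z; rewrite comp_lfunE rq.
- exact: ker_r_filtration.
exact: ker_q_filtration.
Qed.

End Quotients.

Lemma heredity_quasi_hereditary : quasi_hereditary A.
Proof.
pose D k := sval (cid (quotient_exists k)).
pose Dq k := cid (svalP (cid (quotient_exists k))).
pose Dr k := cid (svalP (Dq k)).
apply: (@quotients_quasi_hereditary D (fun k => sval (Dq k)) (fun k => sval (Dr k))) => k;
  by case: (svalP (Dr k)).
Qed.

End ToQuasiHereditary.

(** * The two implications *)

Lemma radical_series_choice (K : fieldType) (A : falgType K) (I : finType)
    (S P : I -> rmod A) (p : forall i, rhom (P i) (S i)) :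
  simple_covers p -> nakayama A ->
  exists (c : I -> nat) (R : forall i, nat -> {vspace (P i)}),
    forall i, radical_series (c i) (R i).
Proof.
move=> SP nak; pose H i := cid (sc_uniserial SP nak i).
exists (fun i => sval (H i)), (fun i => sval (cid (svalP (H i)))) => i.
exact: svalP (cid (svalP (H i))).
Qed.

Lemma max_element (disp : Order.disp_t) (X : porderType disp) (xs : seq X) x :
  x \in xs -> exists2 m, m \in xs & forall y, y \in xs -> ~~ (m < y)%O.
Proof.
elim: xs x => // a xs IH x _; have [->|] := eqVneq xs [::].
  by exists a; rewrite ?inE // => y; rewrite inE => /eqP->; rewrite Order.POrderTheory.ltxx.
case: xs IH => // b xs IH _; have [m mxs mmax] := IH b (mem_head _ _).
have [lma|nlma] := boolP (m < a)%O.
  exists a => [|y]; first exact: mem_head.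
  rewrite inE => /predU1P[->|yxs]; first by rewrite Order.POrderTheory.ltxx.
  by apply: contra (mmax y yxs); apply: Order.POrderTheory.lt_trans.
exists m => [|y]; first by rewrite inE mxs orbT.
by rewrite inE => /predU1P[->|/mmax].
Qed.

Lemma quasi_hereditary_S_connected (K : fieldType) (A : falgType K) :
  nakayama A -> connected_alg A -> quasi_hereditary A -> S_connected A.
Proof.
move=> nak conn [disp [X [S [P [D [p [q [r [sS Sinj Sall pc QH]]]]]]]]].
(* The poset is finite because its elements index pairwise non-isomorphic simples; this provides a
   maximal element and a finite index type. *)
have [xs xsP] : exists xs : seq X, forall x, x \in xs.
  have [I [T [T0 [T1 [sT _ Tall _]]]]] := simple_covers_exist nak.
  have ex i : exists x, rmod_iso (T i) (S x) by apply/Sall/sT.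
  have [g gP] := choice ex; exists (codom g) => x.
  have [i xi] := Tall _ (sS x).
  by rewrite (Sinj x (g i)) ?codom_f //; apply: rmod_iso_trans xi (gP i).
have [T [_ [sT _ _]]] := simple_quo (@submod0 _ _ (regmod A)) (nesym (@regmod_neq0 _ A)).
have [x1 _] := Sall T sT.
have [m _ mmax] := max_element (xsP x1).
pose I : finType := seq_sub xs.
have rp x : is_rhom (p x) by case: (pc x) => _ [].
have rq x : is_rhom (q x) by case: (QH x) => [[]].
have rr x : is_rhom (r x) by case: (QH x) => [_ []].
pose pI (i : I) := Rhom (rp (val i)).
pose qI (i : I) := Rhom (rq (val i)).
pose rI (i : I) := Rhom (rr (val i)).
have SP : @simple_covers _ _ I (fun i => S (val i)) (fun i => P (val i)) pI.
  split=> [i|i j /Sinj/val_inj//|U /Sall[x Ux]|i]; [exact: sS | | exact: pc].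
  by exists (SeqSub (xsP x)).
have [c [R cR]] := radical_series_choice SP nak.
have [s [s_inj s_conn s_lay]] := kupisch SP cR nak conn.
pose i0 : I := SeqSub (xsP m).
have H : heredity #|I| (kup c s i0) 0.
  apply: (@quasi_hereditary_heredity _ _ I _ _ (fun i => D (val i)) pI SP c R cR s i0
    s_inj s_conn s_lay (fun i j => (val i < val j)%O) qI rI) => [i|i|i|i z|i|i].
  - by rewrite Order.POrderTheory.ltxx.
  - by apply/negP/mmax.
  - by case: (QH (val i)) => [[]].
  - by case: (QH (val i)) => _ _ /lfunP/(_ z); rewrite comp_lfunE.
  - case: (QH (val i)) => _ _ _ [t [l sub fac]] _; exists t; split=> // k /fac[N [y lty Ny] FN].
    by exists N => //; exists (SeqSub (xsP y)).
  case: (QH (val i)) => _ _ _ _ [t [l sub fac]]; exists t; split=> // k /fac[N [y lty Ny] FN].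
  by exists N => //; exists (SeqSub (xsP y)).
exact: (heredity_S_connected SP cR s_inj s_conn s_lay H).
Qed.

Lemma S_connected_quasi_hereditary (K : fieldType) (A : falgType K) :
  nakayama A -> connected_alg A -> S_connected A -> quasi_hereditary A.
Proof.
move=> nak conn sc; have [I [S [P [p SP]]]] := simple_covers_exist nak.
have [c [R cR]] := radical_series_choice SP nak.
have [s [s_inj s_conn s_lay]] := kupisch SP cR nak conn.
have [i0 _] := nonzero_hom SP (@regmod_neq0 _ A).
have [x Hx] := S_connected_heredity SP cR i0 s_inj s_conn s_lay sc.
exact: (heredity_quasi_hereditary SP cR s_inj s_conn s_lay Hx).
Qed.

Theorem theorem2p6 (K : closedFieldType) (A : falgType K) :
  nakayama A -> connected_alg A -> ~ semisimple_alg A ->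
  (S_connected A <-> quasi_hereditary A).
Proof.
move=> nak conn _; split.
  exact: S_connected_quasi_hereditary.
exact: quasi_hereditary_S_connected.
Qed.
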